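(* Let $\alpha\in(0,1)$, $p\in[1,2]$, let $(\omega_n)_{n\ge0}$ be a bounded positive weight sequence, and assume that the sequence $(k_n)_{n\ge0}$ defined by $k_0>0$ and $k_n:=k_0\prod_{l=0}^{n-1}\frac1{\omega_l}$, $n\ge1$, satisfies $(k_n)_{n\ge0}\in\ell^\alpha(\mathbb{N})$. Let $\mu$ be the distribution on the complex Banach space $E=\ell^p(\mathbb{N})$ of the random series $$\sum_{n=0}^\infty k_n(\theta_{1,n}+i\theta_{2,n})e_n,$$ where $(\theta_{1,n})_{n\ge0}$, $(\theta_{2,n})_{n\ge0}$ are independent copies of the tempered stable random variable $\theta$ with parameters $\alpha,a_-,a_+,\lambda_-,\lambda_+$ (see context), and let $T$ be the bounded weighted backward shift operator on $E$ defined by $Te_0:=0$, $Te_{n+1}:=\omega_ne_n$, $n\ge0$. Let $(a_j)_{j\in\mathbb{N}}$ and $(b_l)_{l\in\mathbb{N}}$ be two complex $\ell^1(\mathbb{N})$ sequences such that $$\sum_{j=0}^\infty|a_j|\,\|T\|^{jp/2}<\infty.$$ Then, for any pair $(\phi,\psi)$ of functions in $\{\mathrm{Re}(\cdot),-\mathrm{Re}(\cdot),\mathrm{Im}(\cdot),-\mathrm{Im}(\cdot)\}^2$ with $\phi\ne\psi$ and any $x^*,y^*\in E^*$, the functions $$f(z):=\sum_{j=0}^\infty a_je^{i\phi(\langle z,T^{*j}x^*\rangle)}\quad\text{and}\quad g(z):=\sum_{l=0}^\infty b_le^{i\psi(\langle z,T^{*l}y^*\rangle)}$$ are well-defined in $L^2(E,\mu)$,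 and if $T$ is mixing with respect to $\mu$ we have $$|I_n(f,g)|=O_{f,g,\mu,T}\Big(\sum_{l=0}^\infty|b_l|\sum_{j=0}^\infty k_j^{p/2}k_{j+l+n}^{p/2}\Big),\qquad n\ge0.$$
   Context: Tempered stable variable: for $\alpha\in(0,1)$ and $a_-,a_+,\lambda_-,\lambda_+>0$, $\theta$ is a real random variable with characteristic function $$\mathbb{E}[e^{it\theta}]=\exp\Big(\int_{\mathbb{R}}\big(e^{itx}-1-i\kappa(x)tx\big)\lambda(dx)\Big),\ t\in\mathbb{R},\qquad \kappa(x)=\mathbf{1}_{\{|x|<1\}}+\frac1{|x|}\mathbf{1}_{\{|x|\ge1\}},$$ $$\lambda(dx)=a_-\frac{e^{-\lambda_-|x|}}{|x|^{1+\alpha}}\mathbf{1}_{\mathbb{R}^-}(x)\,dx+a_+\frac{e^{-\lambda_+x}}{x^{1+\alpha}}\mathbf{1}_{\mathbb{R}^+}(x)\,dx.$$ All $\theta_{1,n},\theta_{2,n}$, $n\ge0$, are independent and identically distributed as $\theta$. $(e_n)_{n\ge0}$ is the canonical basis of $\ell^p(\mathbb{N})$; $\langle\cdot,\cdot\rangle:E\times E^*\to\mathbb{C}$ is the duality; $T^*$ is the adjoint, $\langle z,T^*x^*\rangle=\langle Tz,x^*\rangle$; $\|T\|$ is the operator norm. $$I_n(f,g):=\int_E f(z)g(T^nz)\,\mu(dz)-\int_E f(z)\,\mu(dz)\int_E g(z)\,\mu(dz),\quad n\ge0.$$ $T$ is mixing if $\lim_{n\to\infty}\mu(A\cap T^{-n}(B))=\mu(A)\mu(B)$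 for all Borel $A,B\subset E$. $u(n)=O_{f,g,\mu,T}(v(n))$, $n\ge0$, means $|u(n)|\le C|v(n)|$ for all $n\ge0$ with a constant $C>0$ that may depend on $f,g,\mu,T$ but not on $n$. *)

(* Defs.v *)
From HB Require Import structures.
From mathcomp Require Import all_boot all_order all_algebra complex.
From mathcomp Require Import all_classical all_reals all_analysis.

Set Implicit Arguments.
Unset Strict Implicit.
Unset Printing Implicit Defensive.

Import Order.TTheory GRing.Theory Num.Theory.
Import numFieldNormedType.Exports.

Local Open Scope classical_set_scope.
Local Open Scope complex_scope.
Local Open Scope ring_scope.

Section complex_analysis.
Context {R : realType}.

(* The norm of a complex normed module is valued in R[i]; rnorm is the same
   norm, valued in R. *)
Definition rnorm {V : normedModType R[i]} (v : V) : R := complex.Re `|v|.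

Definition cmod (z : R[i]) : R := complex.Re `|z|.

Definition cexp (z : R[i]) : R[i] :=
  (expR (complex.Re z))%:C *
  (cos (complex.Im z) +i* sin (complex.Im z)).

Definition cintegral {d} {T : measurableType d} (mu : {measure set T -> \bar R})
    (f : T -> R[i]) : R[i] :=
  (\int[mu]_x complex.Re (f x)) +i* (\int[mu]_x complex.Im (f x)).

Definition in_L2 {d} {T : measurableType d} (mu : {measure set T -> \bar R})
    (f : T -> R[i]) : Prop :=
  [/\ measurable_fun setT (fun x => complex.Re (f x)),
      measurable_fun setT (fun x => complex.Im (f x)) &
      (\int[mu]_x ((cmod (f x)) ^+ 2)%:E < +oo)%E].

Definition sum_series {T : Type} (u : nat -> T -> R[i]) (x : T) : R[i] :=
  limn (series (fun j => u j x) : nat -> R[i]^o).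

(* The series converges at every point, its sum is in L^2(mu), and it also
   converges to this sum in L^2(mu). *)
Definition well_defined_in_L2 {d} {T : measurableType d}
    (mu : {measure set T -> \bar R}) (u : nat -> T -> R[i]) : Prop :=
  [/\ forall x, cvgn (series (fun j => u j x) : nat -> R[i]^o),
      in_L2 mu (sum_series u) &
      (fun N => \int[mu]_x
         ((cmod (series (fun j => u j x) N - sum_series u x)) ^+ 2)%:E)%E
        @ \oo --> 0%E].

End complex_analysis.

Section lp_space.
Context {R : realType} (p : R).

Definition lp_sum (x : nat -> R[i]) : \bar R :=
  (\sum_(0 <= n <oo) (cmod (x n) `^ p)%:E)%E.

Definition lp_pred : {pred nat -> R[i]} := mem [set x | (lp_sum x < +oo)%E].

Definition lp_key : pred_key lp_pred. Proof. exact. Qed.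
Canonical lp_keyed := KeyedPred lp_key.

Lemma lp_sum_ge0 x : (0 <= lp_sum x)%E.
Proof. by apply: nneseries_ge0 => n _ _; rewrite lee_fin powR_ge0. Qed.

Lemma cmod_ge0 (z : R[i]) : 0 <= cmod z.
Proof. by rewrite /cmod normc_def /= sqrtr_ge0. Qed.

Lemma cmodE (z : R[i]) : (cmod z)%:C = `|z|.
Proof. by rewrite /cmod normc_def. Qed.

Lemma cmod0 : cmod (0 : R[i]) = 0.
Proof. by rewrite /cmod normr0. Qed.

Lemma cmodM (y z : R[i]) : cmod (y * z) = cmod y * cmod z.
Proof.
apply: (@complexI R).
by rewrite rmorphM /= !cmodE normrM.
Qed.

Lemma cmodD (y z : R[i]) : cmod (y + z) <= cmod y + cmod z.
Proof. by rewrite -lecR rmorphD /= !cmodE ler_normD. Qed.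

Lemma cmod_eq0 (z : R[i]) : cmod z = 0 -> z = 0.
Proof. by move=> z0; apply/eqP; rewrite -normr_eq0 -cmodE z0. Qed.

Context (p1 : 1 <= p).

Let p0 : 0 < p. Proof. exact: lt_le_trans p1. Qed.

Definition lp_norm (x : nat -> R[i]) : R := fine (lp_sum x) `^ p^-1.

Let N (x : nat -> R[i]) : \bar R :=
  Lnorm counting p%:E (fun n => (cmod (x n))%:E).

Let NE x : N x = (lp_sum x `^ p^-1)%E.
Proof.
rewrite /N Lnorm_counting//; congr (_ `^ _)%E.
apply: eq_eseriesr => n _ /=.
by rewrite ger0_norm ?cmod_ge0.
Qed.

Let N_fin x : (lp_sum x < +oo)%E -> N x = (lp_norm x)%:E.
Proof.
move=> xoo; rewrite NE /lp_norm -poweR_EFin fineK//.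
by rewrite ge0_fin_numE// lp_sum_ge0.
Qed.

Let N_lty x : (N x < +oo)%E -> (lp_sum x < +oo)%E.
Proof.
rewrite NE; case: (lp_sum x) => [r _|/=|//]; first exact: ltry.
by rewrite invr_eq0 gt_eqF.
Qed.

Let N_triangle x y : (N (x + y)%R <= N x + N y)%E.
Proof.
have mf (f : nat -> R) : measurable_fun setT f by [].
apply: le_trans (minkowski_EFin counting (mf (fun n => cmod (x n)))
  (mf (fun n => cmod (y n))) p1).
rewrite /N !Lnorm_counting//.
have s0 (f : nat -> \bar R) : (0 <= \sum_(0 <= k <oo) `|f k| `^ p)%E.
  by apply: nneseries_ge0 => n _ _; exact: poweR_ge0.
apply: gt0_ler_poweR; rewrite ?in_itv/= ?leey ?andbT ?invr_ge0 ?(ltW p0)//.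
- exact: (s0 (EFin \o cmod \o (x + y))).
- exact: (s0 (fun n => (cmod (x n) + cmod (y n))%:E)).
apply: lee_nneseries => [n _ _|n _ /=]; first by rewrite lee_fin powR_ge0.
rewrite lee_fin ge0_ler_powR ?nnegrE ?normr_ge0 ?(ltW p0)//.
rewrite !ger0_norm ?addr_ge0 ?cmod_ge0//.
exact: cmodD.
Qed.

Let lp_norm_triangle x y : (lp_sum x < +oo)%E -> (lp_sum y < +oo)%E ->
  (lp_sum (x + y)%R < +oo)%E -> lp_norm (x + y) <= lp_norm x + lp_norm y.
Proof.
move=> xoo yoo xyoo; have := N_triangle x y.
by rewrite (N_fin xoo) (N_fin yoo) (N_fin xyoo) -EFinD lee_fin.
Qed.

Let lp_norm_eq0 x : (lp_sum x < +oo)%E -> lp_norm x = 0 -> x = 0.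
Proof.
move=> xoo /powR_eq0_eq0 x0; apply/funext => n.
have s0 : lp_sum x = 0%E.
  by rewrite -[LHS]fineK ?x0// ge0_fin_numE ?lp_sum_ge0.
have x_ge0 (i : nat) : (0 <= (cmod (x i) `^ p)%:E)%E.
  by rewrite lee_fin powR_ge0.
have : (\sum_(0 <= i < n.+1) (cmod (x i) `^ p)%:E <= lp_sum x)%E.
  by apply: (nneseries_lim_ge n.+1) => i _ _.
rewrite s0 big_mkord big_ord_recr/= => xn.
apply: cmod_eq0; apply: (@powR_eq0_eq0 _ _ p).
apply/eqP; rewrite eq_le powR_ge0 andbT -lee_fin.
by apply: le_trans xn; rewrite leeDr// sume_ge0.
Qed.

Lemma lp_sumZ (a : R[i]) x : lp_sum (a *: x) = ((cmod a `^ p)%:E * lp_sum x)%E.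
Proof.
rewrite /lp_sum -nneseriesZl; last by move=> n _; rewrite lee_fin powR_ge0.
by apply: eq_eseriesr => n _; rewrite -EFinM -powRM ?cmod_ge0// -cmodM.
Qed.

Lemma lp_submod_closed : submod_closed lp_pred.
Proof.
split=> [|a x y].
  rewrite inE /= /lp_sum eseries0// => n _ _ /=.
  by rewrite cmod0 powR0// gt_eqF.
rewrite !inE /= => xoo yoo; apply: N_lty.
apply: le_lt_trans (N_triangle _ _) _.
have axoo : (lp_sum (a *: x) < +oo)%E.
  by rewrite lp_sumZ lte_mul_pinfty// lee_fin powR_ge0.
by rewrite !N_fin// -EFinD ltry.
Qed.

#[local] HB.instance Definition _ :=
  GRing.isSubmodClosed.Build _ _ lp_pred lp_submod_closed.

(* The space l^p(N) of complex sequences; it is a normed module only for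
   1 <= p, so the proof of this inequality is part of the type. *)
Record ellp (q1 : 1 <= p) := Lp { lp_val :> nat -> R[i]; _ : lp_val \in lp_pred }.

HB.instance Definition _ := [isSub for @lp_val p1].
HB.instance Definition _ := [Choice of ellp p1 by <:].
HB.instance Definition _ := [SubChoice_isSubLmodule of ellp p1 by <:].

Let nrm (x : ellp p1) : R[i] := (lp_norm x)%:C.

Let lp_lty (x : ellp p1) : (lp_sum x < +oo)%E.
Proof. by have := valP x; rewrite inE. Qed.

Let nrmD (x y : ellp p1) : nrm (x + y) <= nrm x + nrm y.
Proof.
suff : lp_norm (val (x + y)) <= lp_norm (val x) + lp_norm (val y).
  have -> : nrm x + nrm y = (lp_norm (val x) + lp_norm (val y))%:C.
    by apply/eqP; rewrite eq_complex /= addr0 !eqxx.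
  by rewrite lecR.
exact: (lp_norm_triangle (lp_lty x) (lp_lty y) (lp_lty (x + y))).
Qed.

Let nrmZ (a : R[i]) (x : ellp p1) : nrm (a *: x) = `|a| * nrm x.
Proof.
have -> : `|a| * nrm x = (cmod a * lp_norm (val x))%:C.
  rewrite -cmodE; apply/eqP.
  by rewrite eq_complex /= !(mulr0, mul0r, addr0, subr0) !eqxx.
congr _%:C.
rewrite /lp_norm (lp_sumZ a (val x)) fineM ?fin_numE//=; last first.
  by rewrite -fin_numE ge0_fin_numE ?lp_sum_ge0 ?lp_lty.
rewrite powRM ?powR_ge0 ?fine_ge0 ?lp_sum_ge0//.
by rewrite -powRrM divff ?gt_eqF// powRr1 ?cmod_ge0.
Qed.

Let nrm0 (x : ellp p1) : nrm x = 0 -> x = 0.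
Proof.
by move=> /complexI x0; apply/val_inj/(lp_norm_eq0 (lp_lty x)).
Qed.

HB.instance Definition _ := Lmodule_isNormed.Build R[i] (ellp p1) nrmD nrmZ nrm0.

(* ellp p1 is equipped with its Borel sigma-algebra. *)
HB.instance Definition _ :=
  Measurable.copy (ellp p1) (g_sigma_algebraType (@open (ellp p1))).

Lemma rnorm_ellp (x : ellp p1) : rnorm x = lp_norm x.
Proof. by []. Qed.

Fact lp_basis_subproof (n : nat) : (fun m => (m == n)%:R : R[i]) \in lp_pred.
Proof.
rewrite inE /= /lp_sum (nneseries_split 0 n.+1); last first.
  by move=> k _; rewrite lee_fin powR_ge0.
rewrite add0n eseries0 ?adde0; last first.
  move=> k /= nk _; rewrite gtn_eqF// cmod0 powR0// gt_eqF//.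
by rewrite sumEFin ltry.
Qed.

Definition lp_basis (n : nat) : ellp p1 := @Lp p1 _ (lp_basis_subproof n).

End lp_space.

Section operators.
Context {R : realType} {E : normedModType R[i]}.

Record dual := Dual {
  dual_fun :> {linear E -> R[i]^o} ;
  dual_continuous : continuous dual_fun }.

Record bounded_operator := BoundedOperator {
  bop_fun :> {linear E -> E} ;
  bop_continuous : continuous bop_fun }.

Definition pairing (z : E) (xs : dual) : R[i] := xs z.

Lemma adjoint_subproof (T : bounded_operator) (xs : dual) :
  continuous (xs \o T : {linear E -> R[i]^o}).
Proof.
move=> z; apply: (@continuous_comp _ _ _ T xs).
  exact: (@bop_continuous T).
exact: (@dual_continuous xs).
Qed.

Definition adjoint (T : bounded_operator) (xs : dual) : dual :=
  @Dual _ (@adjoint_subproof T xs).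

Definition opnorm (T : bounded_operator) : R :=
  sup [set rnorm (T z) | z in [set z | rnorm z <= 1]].

End operators.
Arguments dual {R} E.
Arguments bounded_operator {R} E.

Definition correlation {R : realType} {d} {E : measurableType d}
    (mu : {measure set E -> \bar R}) (T : E -> E) (n : nat) (f g : E -> R[i]) :
    R[i] :=
  cintegral mu (fun z => f z * g (iter n T z)) -
  cintegral mu f * cintegral mu g.

Definition mixing {R : realType} {d} {E : measurableType d}
    (mu : {measure set E -> \bar R}) (T : E -> E) : Prop :=
  forall A B : set E, measurable A -> measurable B ->
    (fun n => mu (A `&` iter n T @^-1` B)) @ \oo --> (mu A * mu B)%E.

Section probability.
Context {R : realType} {d} {Omega : measurableType d} (P : probability Omega R).

Definition mutually_independent {I : eqType} (X : I -> {RV P >-> R}) : Prop :=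
  forall (J : seq I) (A : I -> set R), uniq J ->
    (forall i, measurable (A i)) ->
    P (\bigcap_(i in [set` J]) (X i @^-1` A i)) =
    (\big[*%E/1%E]_(i <- J) P (X i @^-1` A i))%E.

Definition char_fun (X : {RV P >-> R}) (t : R) : R[i] :=
  cintegral P (fun w => cexp (0 +i* (t * X w))).

Definition kappa (x : R) : R :=
  \1_[set y : R | `|y| < 1] x + `|x|^-1 * \1_[set y : R | 1 <= `|y|] x.

(* The density of the Levy measure with respect to the Lebesgue measure. *)
Definition ts_density (alpha a_m a_p l_m l_p x : R) : R :=
  a_m * expR (- l_m * `|x|) / `|x| `^ (1 + alpha) * \1_[set y : R | y < 0] x +
  a_p * expR (- l_p * x) / x `^ (1 + alpha) * \1_[set y : R | 0 < y] x.

Definition tempered_stable (alpha a_m a_p l_m l_p : R) (X : {RV P >-> R}) : Prop :=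
  forall t : R, char_fun X t =
    cexp (cintegral (@lebesgue_measure R) (fun x =>
      (cexp (0 +i* (t * x)) - 1 - (0 +i* (kappa x * t * x))) *
      (ts_density alpha a_m a_p l_m l_p x)%:C)).

End probability.

Definition re_im_maps (R : realType) : set (R[i] -> R) :=
  [set phi | phi = @complex.Re R \/ phi = (fun z => - complex.Re z) \/
             phi = @complex.Im R \/ phi = (fun z => - complex.Im z)].

(* Main.v *)
Require Import Defs.
From mathcomp Require Import all_boot all_order all_algebra complex.
From mathcomp Require Import all_classical all_reals all_analysis.
From mathcomp Require Import measurable_realfun ring lra.

Set Implicit Arguments.
Unset Strict Implicit.
Unset Printing Implicit Defensive.

Import Order.TTheory GRing.Theory Num.Theory.
Import numFieldNormedType.Exports.

Local Open Scope classical_set_scope.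
Local Open Scope complex_scope.
Local Open Scope ring_scope.

(** The functions f and g are normally convergent series of bounded functions,
    since the exponentials have modulus one and the coefficients are summable;
    on a probability space this gives convergence in L^2
    ([normal_series_well_defined_in_L2]).

    For the correlation, write <z, T*^j x> = <T^j z, x> and expand both series:
    by bilinearity I_n(f, g) is the sum over j and l of a_j b_l times the
    covariance of exp (i phi <Z, T*^j x>) and exp (i psi <Z, T*^(l+n) y>). The
    factor of the product of means that comes from g o T^n is the mean of g
    because a mixing measure is invariant ([mixing_invariant]). The exchange of
    sums and integrals is dominated convergence ([cvg_ccov]).

    Each covariance is estimated through independence. A real linear functional
    of Z is a series of independent tempered stable variables with coefficients
    u_i, so the covariance is a limit of differences of two finite products of
    characteristic functions, with factors chi(u_i + v_i) against
    chi(u_i) chi(v_i). All factors lie in the unit disc, hence the difference of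
    products is at most the sum of the differences of the factors
    ([cmod_ccov_cis_sum_le]). One such difference is the covariance of two
    unimodular variables and is controlled by their variances 1 - |chi(u)|^2.
    Since |chi|^2 is the exponential of twice the real part of the Levy exponent
    and the Levy measure has a finite second moment, this variance is
    O(u^2) ([tempered_stable_char_fun_defect]). The difference is thus
    O(|u_i v_i|), and it is at most 2, hence O((|u_i| |v_i|)^(p/2)) as
    p/2 <= 1 ([cmod_char_funD_powR_le]).

    The shift turns k_m e_m into k_(m-j) e_(m-j), so with m the coordinate index
    |u_i| |v_i| is at most a constant times k_(m-j) k_(m-l-n). As
    k_n = omega_n k_(n+1) with omega_n <= ||T||, one has
    k_(m-j) <= ||T||^j k_m. Summing over i = m - l - n gives ||T||^(jp/2) times
    the sum over i of (k_i k_(i+l+n))^(p/2) ([cmod_ccov_shift_le]), and the sum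
    over j converges by the assumption on the a_j. *)

(** * Complex numbers and complex limits *)

Section complex_numbers.
Context {R : realType}.
Implicit Types (z w : R[i]) (s t : R).

Definition cis t : R[i] := cexp (0 +i* t).

Lemma cisE t : cis t = cos t +i* sin t.
Proof.
rewrite /cis /cexp /= expR0; apply/eqP.
by rewrite eq_complex /= !mul1r !mul0r subr0 addr0 !eqxx.
Qed.

Lemma Re_add z w : complex.Re (z + w) = complex.Re z + complex.Re w.
Proof. by case: z w => [? ?] [? ?]. Qed.

Lemma Im_add z w : complex.Im (z + w) = complex.Im z + complex.Im w.
Proof. by case: z w => [? ?] [? ?]. Qed.

Lemma Re_opp z : complex.Re (- z) = - complex.Re z.
Proof. by case: z. Qed.

Lemma Im_opp z : complex.Im (- z) = - complex.Im z.
Proof. by case: z. Qed.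

Lemma Re_mul z w : complex.Re (z * w) =
  complex.Re z * complex.Re w - complex.Im z * complex.Im w.
Proof. by case: z w => [? ?] [? ?]. Qed.

Lemma Im_mul z w : complex.Im (z * w) =
  complex.Re z * complex.Im w + complex.Im z * complex.Re w.
Proof. by case: z w => [? ?] [? ?]. Qed.

Lemma complex_ext z w :
  complex.Re z = complex.Re w -> complex.Im z = complex.Im w -> z = w.
Proof. by case: z w => [? ?] [? ?] /= -> ->. Qed.

Lemma Re_sum I (r : seq I) (P : pred I) (F : I -> R[i]) :
  complex.Re (\sum_(i <- r | P i) F i) = \sum_(i <- r | P i) complex.Re (F i).
Proof. by elim/big_rec2: _ => // i x z _ <-; rewrite Re_add. Qed.

Lemma Im_sum I (r : seq I) (P : pred I) (F : I -> R[i]) :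
  complex.Im (\sum_(i <- r | P i) F i) = \sum_(i <- r | P i) complex.Im (F i).
Proof. by elim/big_rec2: _ => // i x z _ <-; rewrite Im_add. Qed.

Lemma cmod_sqr z : cmod z ^+ 2 = complex.Re z ^+ 2 + complex.Im z ^+ 2.
Proof. by rewrite /cmod normc_def /= sqr_sqrtr// addr_ge0 ?sqr_ge0. Qed.

Lemma cmodN z : cmod (- z) = cmod z.
Proof. by rewrite /cmod normrN. Qed.

Lemma cmod1 : cmod (1 : R[i]) = 1.
Proof. by rewrite /cmod normr1. Qed.

Lemma cmodC z w : cmod (z - w) = cmod (w - z).
Proof. by rewrite -cmodN opprB. Qed.

Lemma cmod_real t : cmod t%:C = `|t|.
Proof. by rewrite /cmod normc_def /= expr0n /= addr0 sqrtr_sqr. Qed.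

Lemma cmod_sum I (r : seq I) (P : pred I) (F : I -> R[i]) :
  cmod (\sum_(i <- r | P i) F i) <= \sum_(i <- r | P i) cmod (F i).
Proof.
elim/big_rec2: _ => [|i x z _ H]; first by rewrite cmod0.
exact: (le_trans (cmodD _ _) (lerD (lexx _) H)).
Qed.

Lemma cmod_prod I (r : seq I) (P : pred I) (F : I -> R[i]) :
  cmod (\prod_(i <- r | P i) F i) = \prod_(i <- r | P i) cmod (F i).
Proof. by elim/big_rec2: _ => [|i x z _ <-]; rewrite ?cmod1// cmodM. Qed.

Lemma normr_Re_le z : `|complex.Re z| <= cmod z.
Proof.
rewrite -(@ler_pXn2r _ 2)// ?nnegrE ?cmod_ge0// cmod_sqr real_normK ?num_real//.
by rewrite lerDl sqr_ge0.
Qed.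

Lemma normr_Im_le z : `|complex.Im z| <= cmod z.
Proof.
rewrite -(@ler_pXn2r _ 2)// ?nnegrE ?cmod_ge0// cmod_sqr real_normK ?num_real//.
by rewrite lerDr sqr_ge0.
Qed.

Lemma cmod_le_ReIm z : cmod z <= `|complex.Re z| + `|complex.Im z|.
Proof.
rewrite -(@ler_pXn2r _ 2)// ?nnegrE ?cmod_ge0 ?addr_ge0//.
rewrite cmod_sqr sqrrD !real_normK ?num_real// addrAC lerDl.
by rewrite mulrn_wge0// mulr_ge0.
Qed.

Lemma cmod_cis t : cmod (cis t) = 1.
Proof.
apply/eqP; rewrite -(@pexpr_eq1 _ _ 2)// ?cmod_ge0//.
by rewrite cmod_sqr cisE /= cos2Dsin2.
Qed.

Lemma cis0 : cis 0 = 1.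
Proof. by rewrite cisE cos0 sin0. Qed.

Lemma cisD s t : cis (s + t) = cis s * cis t.
Proof.
by rewrite !cisE cosD sinD; apply: complex_ext;
  rewrite ?Re_mul ?Im_mul /= 1?addrC.
Qed.

Lemma cis_sum I (r : seq I) (P : pred I) (F : I -> R) :
  cis (\sum_(i <- r | P i) F i) = \prod_(i <- r | P i) cis (F i).
Proof. by elim/big_rec2: _ => [|i x z _ <-]; rewrite ?cis0// cisD. Qed.

Lemma cmodB_le2 z w : cmod z <= 1 -> cmod w <= 1 -> cmod (z - w) <= 2.
Proof.
by move=> z1 w1; apply: (le_trans (cmodD _ _)); rewrite cmodN; apply: lerD.
Qed.

(** Used to bound an integral: a complex number is rotated onto its modulus, so
    that only a real part has to be integrated. *)
Lemma complex_rotation z :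
  exists2 c : R[i], cmod c = 1 & complex.Re (c * z) = cmod z.
Proof.
have [z0|z0] := eqVneq (cmod z) 0.
  by exists 1; rewrite ?cmod1// mul1r z0 (cmod_eq0 z0).
exists (((cmod z)^-1 * complex.Re z) -i* ((cmod z)^-1 * complex.Im z)).
  apply/eqP; rewrite -(@pexpr_eq1 _ _ 2)// ?cmod_ge0// cmod_sqr /=.
  by rewrite sqrrN !exprMn -mulrDr -cmod_sqr -exprMn mulVf// expr1n.
rewrite Re_mul /= mulNr opprK -!mulrA -mulrDr -!expr2 -cmod_sqr expr2.
by rewrite mulrA mulVf// mul1r.
Qed.

(** Telescoping: one factor is exchanged at a time, and the other factors have
    modulus at most one. *)
Lemma cmod_prodB I (r : seq I) (A B : I -> R[i]) :
  (forall i, cmod (A i) <= 1) -> (forall i, cmod (B i) <= 1) ->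
  cmod (\prod_(i <- r) A i - \prod_(i <- r) B i) <=
  \sum_(i <- r) cmod (A i - B i).
Proof.
move=> A1 B1; have prodB1 (s : seq I) : cmod (\prod_(i <- s) B i) <= 1.
  rewrite cmod_prod; elim/big_rec: _ => // i x _ x1.
  have := cmod_ge0 (B i); have := B1 i => B1i B0i.
  by apply: le_trans (ler_wpM2l B0i x1) _; rewrite mulr1.
elim: r => [|i r IH]; first by rewrite !big_nil subrr cmod0.
rewrite !big_cons.
have -> : A i * \prod_(j <- r) A j - B i * \prod_(j <- r) B j =
  A i * (\prod_(j <- r) A j - \prod_(j <- r) B j) +
  (A i - B i) * \prod_(j <- r) B j by ring.
apply: le_trans (cmodD _ _) _; rewrite addrC !cmodM; apply: lerD.
  by rewrite -[leRHS]mulr1 ler_wpM2l ?cmod_ge0.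
apply: le_trans IH; rewrite -[leRHS]mul1r ler_wpM2r ?cmod_ge0//.
Qed.

End complex_numbers.

Section complex_convergence.
Context {R : realType}.

(** Convergence of complex sequences is reduced to that of real and imaginary
    parts, where the theory of real limits applies. *)
Lemma continuous_Re : continuous (@complex.Re R : R[i]^o -> R).
Proof.
move=> z A /nbhs_ballP[e e0 eA]; apply/nbhs_ballP.
exists e%:C; first by rewrite /= ltcR.
move=> w; rewrite /ball /= => zw; apply: eA; rewrite /ball /= -Re_opp -Re_add.
by apply: le_lt_trans (normr_Re_le _) _; rewrite -ltcR cmodE.
Qed.

Lemma continuous_Im : continuous (@complex.Im R : R[i]^o -> R).
Proof.
move=> z A /nbhs_ballP[e e0 eA]; apply/nbhs_ballP.
exists e%:C; first by rewrite /= ltcR.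
move=> w; rewrite /ball /= => zw; apply: eA; rewrite /ball /= -Im_opp -Im_add.
by apply: le_lt_trans (normr_Im_le _) _; rewrite -ltcR cmodE.
Qed.

Lemma cvg_complex (u : nat -> R[i]^o) (l : R[i]^o) :
  (fun n => complex.Re (u n)) @ \oo --> complex.Re l ->
  (fun n => complex.Im (u n)) @ \oo --> complex.Im l ->
  u @ \oo --> l.
Proof.
move=> /cvgrPdist_lt ul /cvgrPdist_lt ul'; apply/cvgrPdist_lt => e e0.
have [e1 e2] : 0 < complex.Re e /\ complex.Im e = 0.
  by move: e0; rewrite ltcE /= => /andP[/eqP -> ->].
have -> : e = (complex.Re e)%:C by apply: complex_ext.
have e3 : 0 < complex.Re e / 2 by rewrite divr_gt0.
near=> n; rewrite -cmodE ltcR; apply: le_lt_trans (cmod_le_ReIm _) _.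
rewrite (splitr (complex.Re e)) Re_add Im_add Re_opp Im_opp; apply: ltrD;
  near: n.
  exact: ul.
exact: ul'.
Unshelve. all: by end_near. Qed.

Lemma cvg_Re (u : nat -> R[i]^o) (l : R[i]^o) :
  u @ \oo --> l -> (fun n => complex.Re (u n)) @ \oo --> complex.Re l.
Proof. by move=> ul; exact: (cvg_comp _ _ ul (@continuous_Re l)). Qed.

Lemma cvg_Im (u : nat -> R[i]^o) (l : R[i]^o) :
  u @ \oo --> l -> (fun n => complex.Im (u n)) @ \oo --> complex.Im l.
Proof. by move=> ul; exact: (cvg_comp _ _ ul (@continuous_Im l)). Qed.

Lemma cvg_complex_unique (u : nat -> R[i]^o) (l l' : R[i]^o) :
  u @ \oo --> l -> u @ \oo --> l' -> l = l'.
Proof.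
move=> ul ul'; apply: complex_ext.
- exact: (cvg_unique (@Rhausdorff R) (cvg_Re ul) (cvg_Re ul')).
- exact: (cvg_unique (@Rhausdorff R) (cvg_Im ul) (cvg_Im ul')).
Qed.

Lemma cvg_cmod0 (u : nat -> R[i]^o) (l : R[i]^o) :
  u @ \oo --> l -> (fun n => cmod (u n - l)) @ \oo --> 0.
Proof.
move=> /cvgrPdist_lt ul; apply/cvgrPdist_lt => e e0.
have e0' : (0 : R[i]) < e%:C by rewrite ltcR.
have := ul _ e0'; apply: filterS => n.
by rewrite -cmodE ltcR sub0r normrN ger0_norm ?cmod_ge0// cmodC.
Qed.

Lemma cvg_complexM (u v : nat -> R[i]^o) (l m : R[i]^o) :
  u @ \oo --> l -> v @ \oo --> m ->
  (fun n => (u n : R[i]) * (v n : R[i]) : R[i]^o) @ \oo -->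
  ((l : R[i]) * (m : R[i]) : R[i]^o).
Proof.
move=> ul vm; have [ru iu] := (cvg_Re ul, cvg_Im ul).
have [rv iv] := (cvg_Re vm, cvg_Im vm).
apply: cvg_complex.
- by under eq_fun do rewrite Re_mul; rewrite Re_mul; apply: cvgB; exact: cvgM.
- by under eq_fun do rewrite Im_mul; rewrite Im_mul; apply: cvgD; exact: cvgM.
Qed.

Lemma cvg_complexB (u v : nat -> R[i]^o) (l m : R[i]^o) :
  u @ \oo --> l -> v @ \oo --> m ->
  (fun n => (u n : R[i]) - (v n : R[i]) : R[i]^o) @ \oo -->
  ((l : R[i]) - (m : R[i]) : R[i]^o).
Proof.
move=> ul vm; have [ru iu] := (cvg_Re ul, cvg_Im ul).
have [rv iv] := (cvg_Re vm, cvg_Im vm).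
apply: cvg_complex.
- by under eq_fun do rewrite Re_add Re_opp; rewrite Re_add Re_opp; exact: cvgB.
- by under eq_fun do rewrite Im_add Im_opp; rewrite Im_add Im_opp; exact: cvgB.
Qed.

Lemma cvg_cis (s : nat -> R) (t : R) :
  s @ \oo --> t -> (fun n => cis (s n) : R[i]^o) @ \oo --> (cis t : R[i]^o).
Proof.
move=> st; apply: cvg_complex.
- under eq_fun do rewrite cisE; rewrite cisE.
  exact: (cvg_comp _ _ st (@continuous_cos R t)).
- under eq_fun do rewrite cisE; rewrite cisE.
  exact: (cvg_comp _ _ st (@continuous_sin R t)).
Qed.

Lemma cmod_lim_le (u : nat -> R[i]^o) (l : R[i]^o) (B : R) :
  u @ \oo --> l -> (forall n, cmod (u n) <= B) -> cmod l <= B.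
Proof.
move=> /cvg_cmod0 ul uB; apply/ler_addgt0Pl => e e0.
have [N _ Ne] := @cvgr_dist_lt _ _ _ _ _ _ _ ul e e0.
have := Ne N (leqnn N); rewrite /= sub0r normrN ger0_norm ?cmod_ge0// => lt_e.
have -> : (l : R[i]) = - (u N - l) + u N by ring.
by apply: le_trans (cmodD _ _) _; rewrite cmodN lerD// ltW.
Qed.

End complex_convergence.

(** * Integrals of bounded complex functions *)

Section bounded_measurable.
Context {R : realType} {d} {T : measurableType d} (P : probability T R).
Implicit Types (f g : T -> R[i]).

Definition bounded_measurable f : Prop :=
  [/\ measurable_fun setT (fun x => complex.Re (f x)),
      measurable_fun setT (fun x => complex.Im (f x)) &
      exists M : R, forall x, cmod (f x) <= M].

Lemma bounded_measurable_cst c : bounded_measurable (fun=> c).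
Proof. by split=> //; exists (cmod c). Qed.

Lemma bounded_measurableD f g : bounded_measurable f -> bounded_measurable g ->
  bounded_measurable (fun x => f x + g x).
Proof.
move=> [f1 f2 [M fM]] [g1 g2 [N gN]]; split.
- by under eq_fun do rewrite Re_add; exact: measurable_funD.
- by under eq_fun do rewrite Im_add; exact: measurable_funD.
- by exists (M + N) => x; apply: le_trans (cmodD _ _) _; exact: lerD.
Qed.

Lemma bounded_measurableM f g : bounded_measurable f -> bounded_measurable g ->
  bounded_measurable (fun x => f x * g x).
Proof.
move=> [f1 f2 [M fM]] [g1 g2 [N gN]]; split.
- under eq_fun do rewrite Re_mul.
  by apply: measurable_funB; exact: measurable_funM.
- under eq_fun do rewrite Im_mul.
  by apply: measurable_funD; exact: measurable_funM.
- by exists (M * N) => x; rewrite cmodM ler_pM ?cmod_ge0.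
Qed.

Lemma bounded_measurableB f g : bounded_measurable f -> bounded_measurable g ->
  bounded_measurable (fun x => f x - g x).
Proof.
move=> bf bg; under eq_fun do rewrite -mulN1r.
apply: bounded_measurableD => //; apply: bounded_measurableM => //.
exact: bounded_measurable_cst.
Qed.

Lemma bounded_measurable_sum I (r : seq I) (F : I -> T -> R[i]) :
  (forall i, bounded_measurable (F i)) ->
  bounded_measurable (fun x => \sum_(i <- r) F i x).
Proof.
move=> bF; elim: r => [|i r IH].
  by under eq_fun do rewrite big_nil; exact: bounded_measurable_cst.
by under eq_fun do rewrite big_cons; exact: bounded_measurableD.
Qed.

Lemma bounded_measurable_prod I (r : seq I) (F : I -> T -> R[i]) :
  (forall i, bounded_measurable (F i)) ->
  bounded_measurable (fun x => \prod_(i <- r) F i x).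
Proof.
move=> bF; elim: r => [|i r IH].
  by under eq_fun do rewrite big_nil; exact: bounded_measurable_cst.
by under eq_fun do rewrite big_cons; exact: bounded_measurableM.
Qed.

Lemma bounded_measurable_cis (X : T -> R) : measurable_fun setT X ->
  bounded_measurable (fun x => cis (X x)).
Proof.
move=> mX; split; last by exists 1 => x; rewrite cmod_cis.
- under eq_fun do rewrite cisE /=.
  by apply: measurableT_comp mX; apply: continuous_measurable_fun => x;
    exact: continuous_cos.
- under eq_fun do rewrite cisE /=.
  by apply: measurableT_comp mX; apply: continuous_measurable_fun => x;
    exact: continuous_sin.
Qed.

Lemma bounded_measurable_real (X : T -> R) (M : R) : measurable_fun setT X ->
  (forall x, `|X x| <= M) -> bounded_measurable (fun x => (X x)%:C).
Proof.
by move=> mX XM; split=> //; exists M => x; rewrite cmod_real.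
Qed.

Lemma bounded_measurable_indic (A : set T) : measurable A ->
  bounded_measurable (fun x => (\1_A x)%:C).
Proof.
move=> mA; apply: (@bounded_measurable_real _ 1) => // x.
by rewrite indicE; case: (_ \in _); rewrite ?normr1 ?normr0.
Qed.

Lemma measurable_cmod f : bounded_measurable f ->
  measurable_fun setT (fun x => cmod (f x)).
Proof.
move=> [f1 f2 _].
have -> : (fun x => cmod (f x)) =
    Num.sqrt \o (fun x => complex.Re (f x) ^+ 2 + complex.Im (f x) ^+ 2).
  by apply/funext => x /=; rewrite -cmod_sqr sqrtr_sqr ger0_norm ?cmod_ge0.
apply: measurableT_comp.
  by apply: continuous_measurable_fun; exact: sqrt_continuous.
by apply: measurable_funD; exact: measurable_funX.
Qed.

Lemma bounded_integrable (X : T -> R) (M : R) : measurable_fun setT X ->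
  (forall x, `|X x| <= M) -> P.-integrable setT (EFin \o X).
Proof.
move=> mX XM; apply: measurable_bounded_integrable => //.
  by rewrite /= ltey_eq fin_num_measure.
exists M; split; first exact: num_real.
by move=> N MN x _ /=; exact: le_trans (XM x) (ltW MN).
Qed.

Lemma integrable_Re f : bounded_measurable f ->
  P.-integrable setT (EFin \o (fun x => complex.Re (f x))).
Proof.
move=> [f1 f2 [M fM]]; apply: (@bounded_integrable _ M) => // x.
exact: le_trans (normr_Re_le _) (fM x).
Qed.

Lemma integrable_Im f : bounded_measurable f ->
  P.-integrable setT (EFin \o (fun x => complex.Im (f x))).
Proof.
move=> [f1 f2 [M fM]]; apply: (@bounded_integrable _ M) => // x.
exact: le_trans (normr_Im_le _) (fM x).
Qed.

Lemma integrable_cmod f : bounded_measurable f ->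
  P.-integrable setT (EFin \o (fun x => cmod (f x))).
Proof.
move=> bf; have [f1 f2 [M fM]] := bf.
apply: (@bounded_integrable _ M); first exact: measurable_cmod.
by move=> x; rewrite ger0_norm ?cmod_ge0.
Qed.

Hint Resolve integrable_Re integrable_Im : core.

Lemma cintegral_cst c : cintegral P (fun=> c) = c.
Proof.
rewrite /cintegral !Rintegral_cst//= probability_setT !mulr1.
by case: c.
Qed.

Lemma cintegralD f g : bounded_measurable f -> bounded_measurable g ->
  cintegral P (fun x => f x + g x) = cintegral P f + cintegral P g.
Proof.
move=> bf bg; apply: complex_ext; rewrite ?Re_add ?Im_add /=.
- by under eq_Rintegral do rewrite Re_add; rewrite RintegralD//; auto.
- by under eq_Rintegral do rewrite Im_add; rewrite RintegralD//; auto.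
Qed.

Lemma integrableZl_real (X : T -> R) r : P.-integrable setT (EFin \o X) ->
  P.-integrable setT (EFin \o (fun x => r * X x)).
Proof. by move=> iX; exact: (@integrableZl _ _ _ P _ measurableT r _ iX). Qed.

Hint Resolve integrableZl_real : core.

Lemma cintegralZl c f : bounded_measurable f ->
  cintegral P (fun x => c * f x) = c * cintegral P f.
Proof.
move=> bf; apply: complex_ext; rewrite ?Re_mul ?Im_mul /=.
- under eq_Rintegral do rewrite Re_mul.
  by rewrite RintegralB ?RintegralZl//; auto.
- under eq_Rintegral do rewrite Im_mul.
  by rewrite RintegralD ?RintegralZl//; auto.
Qed.

Lemma cintegralZr c f : bounded_measurable f ->
  cintegral P (fun x => f x * c) = cintegral P f * c.
Proof.
by move=> bf; rewrite mulrC -cintegralZl//; congr cintegral; apply/funext => x;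
  rewrite mulrC.
Qed.

Lemma cintegralB f g : bounded_measurable f -> bounded_measurable g ->
  cintegral P (fun x => f x - g x) = cintegral P f - cintegral P g.
Proof.
move=> bf bg.
have -> : (fun x => f x - g x) = (fun x => f x + (-1) * g x).
  by apply/funext => x; rewrite mulN1r.
rewrite cintegralD ?cintegralZl ?mulN1r//.
apply: bounded_measurableM => //; exact: bounded_measurable_cst.
Qed.

Lemma cintegral_sum I (r : seq I) (F : I -> T -> R[i]) :
  (forall i, bounded_measurable (F i)) ->
  cintegral P (fun x => \sum_(i <- r) F i x) = \sum_(i <- r) cintegral P (F i).
Proof.
move=> bF; elim: r => [|i r IH].
  by under eq_fun do rewrite big_nil; rewrite cintegral_cst big_nil.
under eq_fun do rewrite big_cons.
rewrite big_cons cintegralD ?IH//; exact: bounded_measurable_sum.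
Qed.

Lemma le_Rintegral_setT (X Y : T -> R) :
  P.-integrable setT (EFin \o X) -> P.-integrable setT (EFin \o Y) ->
  (forall x, X x <= Y x) -> \int[P]_x X x <= \int[P]_x Y x.
Proof. by move=> iX iY XY; apply: le_Rintegral. Qed.

(** Rotating the integral onto the positive half-line turns its modulus into
    the integral of a real part. *)
Lemma cmod_cintegral_le f : bounded_measurable f ->
  cmod (cintegral P f) <= \int[P]_x cmod (f x).
Proof.
move=> bf; set I := cintegral P f.
have [c c1 cI] := complex_rotation I.
rewrite -cI -cintegralZl//=; apply: le_Rintegral_setT => //.
- apply: integrable_Re; apply: bounded_measurableM => //.
  exact: bounded_measurable_cst.
- exact: integrable_cmod.
- move=> x; apply: le_trans (ler_norm _) _; apply: le_trans (normr_Re_le _) _.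
  by rewrite cmodM c1 mul1r.
Qed.

Lemma cmod_cintegral_bound f (M : R) : bounded_measurable f ->
  (forall x, cmod (f x) <= M) -> cmod (cintegral P f) <= M.
Proof.
move=> bf fM; apply: le_trans (cmod_cintegral_le bf) _.
have -> : M = \int[P]_x M by rewrite Rintegral_cst//= probability_setT mulr1.
apply: le_Rintegral_setT => //; first exact: integrable_cmod.
exact: (@bounded_integrable _ `|M|).
Qed.

Lemma cvg_Rintegral_bounded (X : nat -> T -> R) (Y : T -> R) (M : R) :
  (forall n, measurable_fun setT (X n)) -> measurable_fun setT Y ->
  (forall n x, `|X n x| <= M) -> {ae P, forall x, X ^~ x @ \oo --> Y x} ->
  (fun n => \int[P]_x X n x) @ \oo --> \int[P]_x Y x.
Proof.
move=> mX mY XM XY.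
have iM : P.-integrable setT (EFin \o (fun=> M)).
  exact: (@bounded_integrable _ `|M|).
have [|||||iY _ ZY] := @dominated_convergence _ _ _ P _ measurableT
    (fun n => EFin \o X n) (EFin \o Y) (EFin \o (fun=> M)).
- by move=> n; exact/measurable_EFinP.
- exact/measurable_EFinP.
- by apply: filterS XY => x XYx _; apply: cvg_EFin => //; exact: nearW.
- exact: iM.
- by apply: aeW => x n _ /=; rewrite lee_fin.
apply: fine_cvg.
by rewrite fineK//; apply: integrable_fin_num.
Qed.

(** Dominated convergence, the dominating function being a constant. *)
Lemma cvg_cintegral (F : nat -> T -> R[i]) f (M : R) :
  (forall n, bounded_measurable (F n)) -> bounded_measurable f ->
  (forall n x, cmod (F n x) <= M) ->
  {ae P, forall x, (fun n => F n x : R[i]^o) @ \oo --> (f x : R[i]^o)} ->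
  (fun n => cintegral P (F n) : R[i]^o) @ \oo --> (cintegral P f : R[i]^o).
Proof.
move=> bF [f1 f2 _] FM Ff; apply: cvg_complex => /=.
- apply: (@cvg_Rintegral_bounded _ _ M) => //.
  + by move=> n; have [] := bF n.
  + by move=> n x; apply: le_trans (normr_Re_le _) _.
  + apply: filterS Ff => x Ff.
    exact: (cvg_comp _ _ Ff (@continuous_Re R (f x))).
- apply: (@cvg_Rintegral_bounded _ _ M) => //.
  + by move=> n; have [] := bF n.
  + by move=> n x; apply: le_trans (normr_Im_le _) _.
  + apply: filterS Ff => x Ff.
    exact: (cvg_comp _ _ Ff (@continuous_Im R (f x))).
Qed.

End bounded_measurable.

Lemma bounded_measurable_comp {R : realType} {d1 d2}
    {T1 : measurableType d1} {T2 : measurableType d2}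
    (f : T2 -> R[i]) (h : T1 -> T2) :
  measurable_fun setT h -> bounded_measurable f ->
  bounded_measurable (fun x => f (h x)).
Proof.
move=> mh [f1 f2 [M fM]]; split; last by exists M.
- exact: (measurableT_comp f1 mh).
- exact: (measurableT_comp f2 mh).
Qed.

Lemma cintegral_distribution {R : realType} {d1 d2}
    {T1 : measurableType d1} {T2 : measurableType d2}
    (P : probability T1 R) (X : {RV P >-> T2}) (f : T2 -> R[i]) :
  bounded_measurable f ->
  cintegral (distribution P X) f = cintegral P (fun x => f (X x)).
Proof.
move=> bf; have [f1 f2 _] := bf.
have bfX : bounded_measurable (fun x => f (X x)).
  by apply: bounded_measurable_comp.
apply: complex_ext => /=; rewrite /Rintegral integral_distribution//.
- exact/measurable_EFinP.
- exact: integrable_Re.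
- exact/measurable_EFinP.
- exact: integrable_Im.
Qed.

(** * Independence *)

Section independence.
Import HBSimple HBNNSimple.
Context {R : realType} {d} {Omega : measurableType d} (P : probability Omega R).

Lemma cintegral_indic (A : set Omega) : measurable A ->
  cintegral P (fun x => (\1_A x : R)%:C) = (fine (P A))%:C.
Proof.
move=> mA; apply: complex_ext => /=.
- by rewrite /Rintegral /= integral_indic// setIT.
- by rewrite Rintegral_cst// mul0r.
Qed.

(** Simple functions reach every nonnegative bounded function by bounded
    pointwise convergence, so that orthogonality to the events of X is
    orthogonality to the bounded functions of X. *)
Lemma cintegral_mul_comp_ge0 (K : Omega -> R[i]) (X : {RV P >-> R}) :
  bounded_measurable K ->
  (forall A, measurable A ->
    cintegral P (fun x => K x * (\1_A (X x) : R)%:C) = 0) ->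
  forall (g : R -> R) (M : R), measurable_fun setT g ->
    (forall y, 0 <= g y <= M) ->
  cintegral P (fun x => K x * (g (X x))%:C) = 0.
Proof.
move=> bK KA g M mg gM.
have mEg : measurable_fun setT (EFin \o g) by exact/measurable_EFinP.
pose h n := nnsfun_approx measurableT mEg n.
have g0 y : 0 <= g y by case/andP: (gM y).
have hg n y : h n y <= g y.
  rewrite -lee_fin -[leRHS]/((EFin \o g) y) /h nnsfun_approxE.
  by apply: le_approx => // z _; rewrite lee_fin.
have h0 n y : 0 <= h n y by [].
have hM n y : `|h n y| <= M.
  by rewrite ger0_norm//; apply: le_trans (hg n y) _; case/andP: (gM y).
have hcvg y : h n y @[n --> \oo] --> g y.
  apply: (@fine_cvg R _ _ _ (fun n => (h n y)%:E)).
  by apply: (cvg_nnsfun_approx _ mEg) => // z _; rewrite lee_fin.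
have bhX n : bounded_measurable (fun x => (h n (X x))%:C).
  by apply: (@bounded_measurable_real _ _ _ _ M) => //; apply: measurableT_comp.
have bgX : bounded_measurable (fun x => (g (X x))%:C).
  apply: (@bounded_measurable_real _ _ _ _ M) => //;
    first exact: measurableT_comp.
  by move=> x; rewrite ger0_norm//; case/andP: (gM (X x)).
have Kh n : cintegral P (fun x => K x * (h n (X x))%:C) = 0.
  have -> : (fun x => K x * (h n (X x))%:C) = (fun x =>
      \sum_(y <- finmap.enum_fset (fset_set (range (h n))))
        y%:C * (K x * (\1_(h n @^-1` [set y]) (X x) : R)%:C)).
    apply/funext => x; rewrite {1}fimfunE fsbig_finite//= rmorph_sum mulr_sumr.
    by apply: eq_bigr => y _; rewrite rmorphM /= mulrCA.
  have bK1 y : bounded_measurable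
      (fun x => K x * (\1_(h n @^-1` [set y]) (X x) : R)%:C).
    apply: bounded_measurableM => //.
    apply: (@bounded_measurable_comp _ _ _ _ _
      (fun z => (\1_(h n @^-1` [set y]) z : R)%:C) X) => //.
    exact: bounded_measurable_indic.
  rewrite cintegral_sum => [|y]; last first.
    by apply: bounded_measurableM => //; exact: bounded_measurable_cst.
  by apply: big1_seq => y _; rewrite cintegralZl// KA ?mulr0.
have [_ _ [N KN]] := bK.
have : (fun n => cintegral P (fun x => K x * (h n (X x))%:C) : R[i]^o) @ \oo -->
       (cintegral P (fun x => K x * (g (X x))%:C) : R[i]^o).
  apply: (@cvg_cintegral _ _ _ _ _ _ (N * M)).
  - by move=> n; exact: bounded_measurableM.
  - exact: bounded_measurableM.
  - by move=> n x; rewrite cmodM cmod_real ler_pM ?cmod_ge0.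
  - apply: aeW => x; apply: cvg_complex.
    + under eq_fun do rewrite Re_mul /= mulr0 subr0.
      by rewrite Re_mul /= mulr0 subr0; apply: cvgMr; exact: hcvg.
    + under eq_fun do rewrite Im_mul /= mulr0 add0r.
      by rewrite Im_mul /= mulr0 add0r; apply: cvgMr; exact: hcvg.
under eq_fun do rewrite Kh.
by move=> /cvg_complex_unique -/(_ 0); apply; exact: cvg_cst.
Qed.

(** A bounded complex function of X is a combination of nonnegative ones, once a
    constant is added to its real and imaginary parts; K has integral zero
    because the whole line is one of the events. *)
Lemma cintegral_mul_comp (K : Omega -> R[i]) (X : {RV P >-> R}) :
  bounded_measurable K ->
  (forall A, measurable A ->
    cintegral P (fun x => K x * (\1_A (X x) : R)%:C) = 0) ->
  forall g : R -> R[i], bounded_measurable g ->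
  cintegral P (fun x => K x * g (X x)) = 0.
Proof.
move=> bK KA g [g1 g2 [M gM]].
have K0 : cintegral P K = 0.
  rewrite -[RHS](KA setT)//; congr cintegral; apply/funext => x.
  by rewrite indicT mulr1.
have shift (h : R -> R) : measurable_fun setT h -> (forall y, `|h y| <= M) ->
    cintegral P (fun x => K x * (h (X x))%:C) = 0.
  move=> mh hM.
  have b1 : bounded_measurable (fun x => K x * (h (X x) + M)%:C).
    apply: bounded_measurableM => //.
    apply: (@bounded_measurable_real _ _ _ _ (M + M)).
      by apply: measurable_funD => //; exact: measurableT_comp.
    move=> x; have := hM (X x); rewrite !ler_norml => /andP[? ?].
    by apply/andP; split; lra.
  have -> : (fun x => K x * (h (X x))%:C) =
      (fun x => K x * (h (X x) + M)%:C - K x * M%:C).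
    by apply/funext => x; rewrite rmorphD /= mulrDr addrK.
  rewrite cintegralB//; last first.
    by apply: bounded_measurableM => //; exact: bounded_measurable_cst.
  rewrite cintegralZr// K0 mul0r subr0.
  apply: (@cintegral_mul_comp_ge0 K X bK KA (fun y => h y + M) (M + M)).
    exact: measurable_funD.
  by move=> y; have := hM y; rewrite ler_norml => /andP[? ?]; apply/andP;
    split; lra.
have b (h : R -> R) : measurable_fun setT h -> (forall y, `|h y| <= M) ->
    bounded_measurable (fun x => K x * (h (X x))%:C).
  move=> mh hM; apply: bounded_measurableM => //.
  by apply: (@bounded_measurable_real _ _ _ _ M) => //; exact: measurableT_comp.
have -> : (fun x => K x * g (X x)) = (fun x => K x * (complex.Re (g (X x)))%:C +
    (0 +i* 1) * (K x * (complex.Im (g (X x)))%:C)).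
  apply/funext => x; rewrite mulrCA -mulrDr; congr (_ * _).
  by apply: complex_ext; rewrite ?Re_add ?Im_add ?Re_mul ?Im_mul /=; ring.
have gR y : `|complex.Re (g y)| <= M by apply: le_trans (normr_Re_le _) _.
have gI y : `|complex.Im (g y)| <= M by apply: le_trans (normr_Im_le _) _.
rewrite cintegralD ?cintegralZl; last 3 first.
- exact: (b (fun y => complex.Im (g y))).
- exact: (b (fun y => complex.Re (g y))).
- apply: bounded_measurableM; first exact: bounded_measurable_cst.
  exact: (b (fun y => complex.Im (g y))).
rewrite (shift (fun y => complex.Re (g y)))//.
rewrite (shift (fun y => complex.Im (g y)))//.
by rewrite mulr0 addr0.
Qed.

Context {I : choiceType} (X : I -> {RV P >-> R}) (iX : mutually_independent X).

Lemma cintegral_prod_indic (s : seq I) (A : I -> set R) : uniq s ->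
  (forall i, measurable (A i)) ->
  cintegral P (fun x => \prod_(i <- s) (\1_(A i) (X i x) : R)%:C) =
  \prod_(i <- s) (fine (P (X i @^-1` A i)))%:C.
Proof.
move=> us mA.
have mXA i : measurable (X i @^-1` A i).
  by rewrite -[X in measurable X]setTI; exact: measurable_funP.
have -> : (fun x => \prod_(i <- s) (\1_(A i) (X i x) : R)%:C) =
    (fun x => (\1_(\bigcap_(i in [set` s]) (X i @^-1` A i)) x : R)%:C).
  apply/funext => x; elim: {us} s => [|i s IH].
    by rewrite bigcap_seq !big_nil indicT.
  by rewrite bigcap_seq !big_cons IH -rmorphM /= bigcap_seq indicI.
rewrite cintegral_indic; last first.
  by rewrite bigcap_seq; exact: bigsetI_measurable.
rewrite iX//; elim: {us} s => [|i s IH]; first by rewrite !big_nil.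
have fP j : P (X j @^-1` A j) \is a fin_num by exact: fin_num_measure.
rewrite !big_cons fineM//; last first.
  by elim/big_rec: _ => // j y _ fy; rewrite fin_numM.
by rewrite rmorphM /= IH.
Qed.

(** The hypothesis speaks of events only. Events are replaced by bounded
    functions one index at a time, which is why the product mixes functions
    (over r) with indicators (over s). At each replacement the product of the
    other factors, once centred, is orthogonal to every event of the new
    variable. *)
Lemma cintegral_prod_mixed (r s : seq I) (g : I -> R -> R[i]) (A : I -> set R) :
  uniq (r ++ s) -> (forall i, bounded_measurable (g i)) ->
  (forall i, measurable (A i)) ->
  cintegral P (fun x => (\prod_(i <- r) g i (X i x)) *
                         \prod_(i <- s) (\1_(A i) (X i x) : R)%:C) =
  (\prod_(i <- r) cintegral P (fun x => g i (X i x))) *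
  \prod_(i <- s) (fine (P (X i @^-1` A i)))%:C.
Proof.
move=> + bg; elim: r s A => [|i r IH] s A /=.
  move=> us mA; rewrite big_nil mul1r -cintegral_prod_indic//.
  by congr cintegral; apply/funext => x; rewrite big_nil mul1r.
rewrite mem_cat negb_or => /andP[/andP[ir is_] urs] mA.
pose H x := (\prod_(j <- r) g j (X j x)) *
            \prod_(j <- s) (\1_(A j) (X j x) : R)%:C.
have bgX j : bounded_measurable (fun x => g j (X j x)).
  exact: bounded_measurable_comp.
have b1X j B : measurable B ->
    bounded_measurable (fun x => (\1_B (X j x) : R)%:C).
  move=> mB; apply: (@bounded_measurable_comp _ _ _ _ _
    (fun z => (\1_B z : R)%:C) (X j)) => //.
  exact: bounded_measurable_indic.
have bH : bounded_measurable H.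
  by apply: bounded_measurableM; apply: bounded_measurable_prod => j; auto.
have bHc : bounded_measurable (fun x => H x - cintegral P H).
  by apply: bounded_measurableB => //; exact: bounded_measurable_cst.
have HB B : measurable B ->
    cintegral P (fun x => (H x - cintegral P H) * (\1_B (X i x) : R)%:C) = 0.
  (* The induction hypothesis is applied to i :: s, with the event B at i. *)
  move=> mB; pose A' j := if j == i then B else A j.
  have mA' j : measurable (A' j) by rewrite /A'; case: ifP.
  have A'i : A' i = B by rewrite /A' eqxx.
  have A's j : j \in s -> A' j = A j.
    by move=> js; rewrite /A'; case: eqP js => // ->; rewrite (negbTE is_).
  have u' : uniq (r ++ i :: s).
    by rewrite -cat1s uniq_catCA /= mem_cat negb_or ir is_.
  have := IH (i :: s) A' u' mA'; rewrite big_cons A'i.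
  under [in X in _ * (_ * X)]eq_big_seq => j js do rewrite A's//.
  rewrite mulrCA -(IH s A)// -/H => HIH.
  have -> : (fun x => (H x - cintegral P H) * (\1_B (X i x) : R)%:C) =
    (fun x => H x * (\1_B (X i x) : R)%:C -
              cintegral P H * (\1_B (X i x) : R)%:C).
    by apply/funext => x; rewrite mulrBl.
  rewrite cintegralB; last 2 first.
  - by apply: bounded_measurableM => //; exact: b1X.
  - by apply: bounded_measurableM; [exact: bounded_measurable_cst|exact: b1X].
  rewrite cintegralZl; last exact: b1X.
  have -> : cintegral P (fun x => (\1_B (X i x) : R)%:C) =
      (fine (P (X i @^-1` B)))%:C.
    rewrite -cintegral_indic//.
    by rewrite -[X in measurable X]setTI; exact: measurable_funP.
  apply/eqP; rewrite subr_eq0 [X in _ == X]mulrC -HIH; apply/eqP.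
  congr cintegral; apply/funext => x; rewrite big_cons A'i mulrCA mulrC.
  by congr (_ * _); rewrite /H; congr (_ * _); apply: eq_big_seq => j js;
    rewrite A's.
have bHg : bounded_measurable (fun x => H x * g i (X i x)).
  exact: bounded_measurableM.
have := @cintegral_mul_comp _ (X i) bHc HB _ (bg i).
under eq_fun do rewrite mulrBl.
rewrite cintegralB//; last first.
  by apply: bounded_measurableM => //; exact: bounded_measurable_cst.
rewrite cintegralZl// => /eqP; rewrite subr_eq0 => /eqP Hg.
rewrite big_cons -mulrA mulrC -IH// -/H -Hg; congr cintegral.
by apply/funext => x; rewrite big_cons /H [RHS]mulrC mulrA.
Qed.

Lemma cintegral_prod_independent (r : seq I) (g : I -> R -> R[i]) :
  uniq r -> (forall i, bounded_measurable (g i)) ->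
  cintegral P (fun x => \prod_(i <- r) g i (X i x)) =
  \prod_(i <- r) cintegral P (fun x => g i (X i x)).
Proof.
move=> ur bg; have := @cintegral_prod_mixed r [::] g (fun=> setT).
rewrite cats0 big_nil mulr1 => <-//; congr cintegral.
by apply/funext => x; rewrite big_nil mulr1.
Qed.

End independence.

(** * Tempered stable laws *)

Section real_estimates.
Context {R : realType}.
Implicit Types (x : R).

Lemma normr_sin_le x : `|sin x| <= `|x|.
Proof.
wlog x0 : x / 0 <= x => [H|].
  have [|x0] := leP 0 x; first exact: H.
  by rewrite -normrN -sinN -[leRHS]normrN; apply: H; rewrite oppr_ge0 ltW.
have csin : {within `[0, x], continuous (@sin R)}.
  by apply: continuous_subspaceT => z; exact: continuous_sin.
have [c _] := MVT_segment x0 (fun z _ => is_derive_sin z) csin.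
rewrite sin0 !subr0 => ->; rewrite normrM ler_piMl//.
exact: cos_max.
Qed.

Lemma cos_ge1Bsqr x : 1 - cos x <= x ^+ 2.
Proof.
have -> : 1 - cos x = 2 * sin (x / 2) ^+ 2.
  rewrite {1}(splitr x) cosD -!expr2; have := cos2Dsin2 (x / 2); lra.
have : sin (x / 2) ^+ 2 <= (x / 2) ^+ 2.
  rewrite -[leLHS]real_normK ?num_real// -[leRHS]real_normK ?num_real//.
  by rewrite ler_pXn2r ?nnegrE//; exact: normr_sin_le.
rewrite expr_div_n => h; have := sqr_ge0 x; lra.
Qed.

(** By evenness this is twice the mass of an exponential law, up to the rate. *)
Lemma integrable_laplace (c : R) : 0 < c ->
  (@lebesgue_measure R).-integrable setT (EFin \o (fun x => expR (- c * `|x|))).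
Proof.
move=> c0.
have cf : continuous (fun x : R => expR (- c * `|x|)).
  move=> x; apply: continuous_comp; last exact: continuous_expR.
  by apply: continuousM; [exact: cst_continuous|exact: norm_continuous].
have mf : measurable_fun setT (fun x : R => expR (- c * `|x|)).
  exact: continuous_measurable_fun.
apply/integrableP; split; first exact/measurable_EFinP.
under eq_integral do rewrite gee0_abs ?lee_fin ?expR_ge0//.
rewrite (ge0_symfun_integralT _ cf); last 2 first.
- by move=> x; exact: expR_ge0.
- by move=> x /=; rewrite normrN.
have -> : (\int[lebesgue_measure]_(x in [set x : R | (0 <= x)%R])
      (expR (- c * `|x|))%:E =
    (c^-1)%R%:E * \int[lebesgue_measure]_x (exponential_pdf c x)%:E)%E.
  rewrite -ge0_integralZl//; last 3 first.
  - by apply/measurable_EFinP; exact: measurable_exponential_pdf.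
  - by move=> x _; rewrite lee_fin exponential_pdf_ge0// ltW.
  - by rewrite lee_fin invr_ge0 ltW.
  rewrite [LHS]integral_mkcond; apply: eq_integral => x _.
  rewrite /exponential_pdf !patchE.
  have -> : (x \in `[0, +oo[%classic) = (x \in [set x : R | 0 <= x]).
    by rewrite set_itvcy.
  case: ifPn => [|_]; last by rewrite mule0.
  by rewrite inE /= => x0; rewrite -EFinM mulrA mulVf ?gt_eqF// mul1r ger0_norm.
by rewrite integral_exponential_pdf// mule1 -EFinM ltry.
Qed.

(** At the origin the square absorbs the singularity since alpha < 1; at
    infinity half of the exponential absorbs the power. *)
Lemma tempered_second_moment_le (a l c alpha x : R) : 0 < a -> 0 < alpha < 1 ->
  0 < c -> c + c <= l -> 0 < x ->
  x ^+ 2 * (a * expR (- l * x) / x `^ (1 + alpha)) <=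
  a * (1 + c^-1) * expR (- c * x).
Proof.
move=> a0 /andP[al0 al1] c0 cl x0.
have -> : x ^+ 2 * (a * expR (- l * x) / x `^ (1 + alpha)) =
    a * (expR (- l * x) * x `^ (1 - alpha)).
  rewrite -powR_mulrn ?ltW// -powRN mulrC -!mulrA; congr (_ * (_ * _)).
  rewrite -powRD; last by apply/implyP => _; rewrite gt_eqF.
  by congr powR; lra.
have h1 : x `^ (1 - alpha) <= 1 + x.
  have [x1|x1] := leP x 1.
    rewrite (le_trans (y := 1 : R))// ?lerDl ?(ltW x0)//.
    have : x `^ (1 - alpha) <= 1 `^ (1 - alpha).
      by rewrite ge0_ler_powR ?nnegrE ?(ltW x0)// subr_ge0 ltW.
    by rewrite powR1.
  rewrite (le_trans (y := x))// ?lerDr//.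
  by rewrite ler1_powR ?ltW// gtrBl.
have h2 : 1 + x <= (1 + c^-1) * expR (c * x).
  rewrite mulrDl mul1r lerD//.
    by rewrite -[leLHS]expR0 ler_expR mulr_ge0// ltW.
  rewrite mulrC ler_pdivlMr// mulrC.
  by apply: le_trans (expR_ge1Dx _); rewrite lerDr.
rewrite -mulrA ler_pM2l//.
apply: (@le_trans _ _ (expR (- l * x) * ((1 + c^-1) * expR (c * x)))).
  by rewrite ler_wpM2l ?expR_ge0// (le_trans h1).
rewrite mulrCA -expRD ler_wpM2l ?addr_ge0 ?invr_ge0 ?(ltW c0)//.
by rewrite ler_expR -mulrDl ler_wpM2r ?(ltW x0)//; lra.
Qed.

End real_estimates.

Section tempered_stable_law.
Context {R : realType} (alpha a_m a_p l_m l_p : R).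
Hypotheses (halpha : 0 < alpha < 1) (ham : 0 < a_m) (hap : 0 < a_p)
  (hlm : 0 < l_m) (hlp : 0 < l_p).

Let dens := ts_density alpha a_m a_p l_m l_p.

Lemma ts_density_ge0 x : 0 <= dens x.
Proof.
by rewrite /dens /ts_density addr_ge0 ?mulr_ge0 ?expR_ge0 ?invr_ge0 ?powR_ge0
  ?(ltW ham) ?(ltW hap) // indicE.
Qed.

Lemma measurable_ts_density : measurable_fun setT dens.
Proof.
have mlt : measurable [set y : R | y < 0].
  by rewrite -set_itvNyo; exact: measurable_itv.
have mgt : measurable [set y : R | 0 < y].
  by rewrite -set_itvoy; exact: measurable_itv.
rewrite /dens /ts_density.
have mpart a l : measurable_fun setT
    (fun x : R => a * expR (- l * x) / x `^ (1 + alpha)).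
  under eq_fun do rewrite -powRN.
  apply: measurable_funM; last exact: measurable_powR.
  by apply: measurable_funM => //; apply: measurableT_comp => //;
    exact: mulrl_measurable.
apply: measurable_funD; (apply: measurable_funM; last exact: measurable_indic).
- exact: (measurableT_comp (mpart a_m l_m) (@normr_measurable R setT)).
- exact: mpart.
Qed.

Lemma second_moment_density_le (c x : R) :
  0 < c -> c + c <= l_m -> c + c <= l_p ->
  x ^+ 2 * dens x <= (a_m + a_p) * (1 + c^-1) * expR (- c * `|x|).
Proof.
move=> c0 cm cp.
have ind_neg : (\1_[set y : R | y < 0] x : R) = (x < 0)%R%:R.
  by rewrite indicE; congr (nat_of_bool _)%:R; apply/idP/idP => [/set_mem//|h];
    exact: mem_set.
have ind_pos : (\1_[set y : R | 0 < y] x : R) = (0 < x)%R%:R.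
  by rewrite indicE; congr (nat_of_bool _)%:R; apply/idP/idP => [/set_mem//|h];
    exact: mem_set.
have c1 : 0 <= 1 + c^-1 by rewrite addr_ge0// invr_ge0 ltW.
rewrite /dens /ts_density ind_neg ind_pos.
have [x0|x0|->] := ltgtP x 0; rewrite ?(mulr0, mulr1, addr0, add0r).
- rewrite -[x ^+ 2]real_normK ?num_real//.
  have nx0 : 0 < `|x| by rewrite normr_gt0 lt_eqF.
  apply: le_trans (tempered_second_moment_le ham halpha c0 cm nx0) _.
  by rewrite ler_wpM2r ?expR_ge0// ler_wpM2r// lerDl ltW.
- rewrite (ger0_norm (ltW x0)).
  apply: le_trans (tempered_second_moment_le hap halpha c0 cp x0) _.
  by rewrite ler_wpM2r ?expR_ge0// ler_wpM2r// lerDr ltW.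
- by rewrite mulr_ge0 ?expR_ge0// mulr_ge0// addr_ge0 ?(ltW ham) ?(ltW hap).
Qed.

(** Finiteness of this moment is what makes 1 - |chi(u)|^2 quadratic in u, for
    chi the characteristic function. *)
Lemma integrable_second_moment :
  (@lebesgue_measure R).-integrable setT (EFin \o (fun x => x ^+ 2 * dens x)).
Proof.
(* At most half of both rates, so that one exponential covers both sides. *)
pose c := Num.min l_m l_p / 2.
have c0 : 0 < c by rewrite divr_gt0// lt_min hlm.
have cm : c + c <= l_m by rewrite -splitr ge_min lexx.
have cp : c + c <= l_p by rewrite -splitr ge_min lexx orbT.
have iA := @integrableZl _ _ _ _ _ measurableT ((a_m + a_p) * (1 + c^-1)) _
  (integrable_laplace c0).
apply: (le_integrable measurableT _ _ iA).
- apply/measurable_EFinP; apply: measurable_funM => //.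
  exact: measurable_ts_density.
- move=> x _ /=; rewrite lee_fin [leLHS]ger0_norm.
    by apply: le_trans (ler_norm _); exact: second_moment_density_le.
  by rewrite mulr_ge0 ?sqr_ge0 ?ts_density_ge0.
Qed.

Context {d} {Omega : measurableType d} (P : probability Omega R).

(** The squared modulus of the characteristic function is the exponential of
    twice the real part of the Levy exponent, which is the integral of cos - 1;
    and 1 - cos is at most quadratic. *)
Lemma tempered_stable_char_fun_defect : exists2 C : R, 0 <= C &
  forall X : {RV P >-> R}, tempered_stable alpha a_m a_p l_m l_p X ->
  forall t, 1 - cmod (char_fun X t) ^+ 2 <= C * t ^+ 2.
Proof.
pose D := \int[@lebesgue_measure R]_x (x ^+ 2 * dens x).
have D0 : 0 <= D.
  by apply: Rintegral_ge0 => x _; rewrite mulr_ge0 ?sqr_ge0 ?ts_density_ge0.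
exists (2 * D); first by rewrite mulr_ge0.
move=> X /(_ _) Xts t; rewrite Xts /cexp cmodM -/(cexp _).
set z := cintegral _ _.
have -> : cmod (cos (complex.Im z) +i* sin (complex.Im z)) = 1.
  by rewrite -cisE cmod_cis.
rewrite mulr1 cmod_real ger0_norm ?expR_ge0// expr2 -expRD.
suff zD : - (t ^+ 2 * D) <= complex.Re z.
  have := expR_ge1Dx (complex.Re z + complex.Re z); lra.
have intD : (@lebesgue_measure R).-integrable setT
    (EFin \o (fun x => - t ^+ 2 * (x ^+ 2 * dens x))).
  exact: (@integrableZl _ _ _ _ _ measurableT (- t ^+ 2) _
    integrable_second_moment).
rewrite -mulNr /D -RintegralZl//; last exact: integrable_second_moment.
have integrandE x : complex.Re ((cexp (0 +i* (t * x)) - 1 -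
    (0 +i* (kappa x * t * x))) * (ts_density alpha a_m a_p l_m l_p x)%:C) =
    (cos (t * x) - 1) * dens x.
  by rewrite -[cexp _]/(cis _) cisE Re_mul !Re_add !Re_opp /= mulr0 !subr0.
have -> : complex.Re z =
    \int[@lebesgue_measure R]_x ((cos (t * x) - 1) * dens x).
  by rewrite /z /cintegral /complex.Re; apply: eq_Rintegral => x _;
    exact: integrandE.
have bound x : 0 <= (1 - cos (t * x)) * dens x <= t ^+ 2 * (x ^+ 2 * dens x).
  rewrite mulr_ge0 ?ts_density_ge0 ?subr_ge0 ?cos_le1//= mulrA.
  rewrite ler_wpM2r ?ts_density_ge0// -exprMn; exact: cos_ge1Bsqr.
apply: le_Rintegral => //.
  apply: (le_integrable measurableT _ _ intD).
    apply/measurable_EFinP; apply: measurable_funM;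
      last exact: measurable_ts_density.
    apply: measurable_funB => //; apply: measurableT_comp.
      by apply: continuous_measurable_fun => y; exact: continuous_cos.
    exact: measurable_funM.
  move=> x _ /=; rewrite lee_fin.
  rewrite -[leLHS]normrN -mulNr opprB -[leRHS]normrN -mulNr opprK.
  by have /andP[b1 b2] := bound x; rewrite !ger0_norm// (le_trans b1 b2).
move=> x _; have /andP[_] := bound x; lra.
Qed.

End tempered_stable_law.

(** * Covariance of characters *)

Section complex_covariance.
Context {R : realType} {d} {T : measurableType d} (P : probability T R).
Implicit Types (F G : T -> R[i]).

(** Bilinear, with no conjugation of the second factor, to match correlations of
    the form of the integral of f (g o T^n). *)
Definition ccov F G : R[i] :=
  cintegral P (fun x => F x * G x) - cintegral P F * cintegral P G.

Lemma ccovE F G : bounded_measurable F -> bounded_measurable G ->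
  ccov F G =
  cintegral P (fun x => (F x - cintegral P F) * (G x - cintegral P G)).
Proof.
move=> bF bG; set a := cintegral P F; set b := cintegral P G.
have -> : (fun x => (F x - a) * (G x - b)) =
    (fun x => (F x * G x - a * G x) - (b * F x - a * b)).
  by apply/funext => x; ring.
have bFG := bounded_measurableM bF bG.
have baG := bounded_measurableM (bounded_measurable_cst (T := T) a) bG.
have bbF := bounded_measurableM (bounded_measurable_cst (T := T) b) bF.
have bab := bounded_measurable_cst (T := T) (a * b).
have bl := bounded_measurableB bFG baG; have br := bounded_measurableB bbF bab.
rewrite (cintegralB P bl br) (cintegralB P bFG baG) (cintegralB P bbF bab).
rewrite cintegral_cst !cintegralZl//.
by rewrite /ccov -/a -/b; ring.
Qed.

Lemma Rintegral_cmod_center F : bounded_measurable F ->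
  (forall x, cmod (F x) = 1) ->
  \int[P]_x (cmod (F x - cintegral P F) ^+ 2) = 1 - cmod (cintegral P F) ^+ 2.
Proof.
move=> bF F1; set a := cintegral P F.
pose c : R[i] := (complex.Re a *+ 2) -i* (complex.Im a *+ 2).
have pw x : cmod (F x - a) ^+ 2 = (1 + cmod a ^+ 2) - complex.Re (c * F x).
  have := cmod_sqr (F x); rewrite F1 expr1n => h.
  by rewrite h !cmod_sqr !Re_add !Im_add !Re_opp !Im_opp !Re_mul /c /=; ring.
under eq_Rintegral do rewrite pw.
have bcF : bounded_measurable (fun x => c * F x).
  by apply: bounded_measurableM => //; exact: bounded_measurable_cst.
rewrite RintegralB//; last 2 first.
- exact: (@bounded_integrable _ _ _ _ _ `|1 + cmod a ^+ 2|).
- exact: integrable_Re.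
rewrite Rintegral_cst//= probability_setT /= mulr1.
have -> : \int[P]_x complex.Re (c * F x) = complex.Re (c * a).
  by rewrite -cintegralZl.
by rewrite !cmod_sqr Re_mul /c /=; ring.
Qed.

(** The arithmetic-geometric inequality with a free weight t stands in for the
    Cauchy-Schwarz inequality; for unimodular F, the variance is
    1 - |EF|^2. *)
Lemma cmod_ccov_le F G (t : R) : bounded_measurable F -> bounded_measurable G ->
  (forall x, cmod (F x) = 1) -> (forall x, cmod (G x) = 1) -> 0 < t ->
  cmod (ccov F G) <= (t * (1 - cmod (cintegral P F) ^+ 2) +
                      t^-1 * (1 - cmod (cintegral P G) ^+ 2)) / 2.
Proof.
move=> bF bG F1 G1 t0; rewrite ccovE//.
have bF' : bounded_measurable (fun x => F x - cintegral P F).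
  by apply: bounded_measurableB => //; exact: bounded_measurable_cst.
have bG' : bounded_measurable (fun x => G x - cintegral P G).
  by apply: bounded_measurableB => //; exact: bounded_measurable_cst.
apply: le_trans (cmod_cintegral_le _ (bounded_measurableM bF' bG')) _.
have isqr H : bounded_measurable H ->
    P.-integrable setT (EFin \o (fun x => cmod (H x) ^+ 2)).
  move=> bH; have := integrable_cmod P (bounded_measurableM bH bH).
  by under eq_fun do rewrite cmodM -expr2.
have isqrZ H s : bounded_measurable H ->
    P.-integrable setT (EFin \o (fun x => s * cmod (H x) ^+ 2)).
  move=> bH; apply: integrableZl_real; exact: isqr.
rewrite -!Rintegral_cmod_center// -!RintegralZl//; try exact: isqr.
rewrite -RintegralD//; try exact: isqrZ.
have isqrD : P.-integrable setT (EFin \o (fun x =>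
    t * cmod (F x - cintegral P F) ^+ 2 +
    t^-1 * cmod (G x - cintegral P G) ^+ 2)).
  exact: (integrableD measurableT (isqrZ _ t bF') (isqrZ _ t^-1 bG')).
rewrite -RintegralZr//; apply: le_Rintegral_setT.
- apply: integrable_cmod; exact: bounded_measurableM.
- by under eq_fun do rewrite mulrC; exact: integrableZl_real.
- move=> x; rewrite cmodM; set y := cmod _; set z := cmod _.
  rewrite ler_pdivlMr// -subr_ge0.
  have -> : t * y ^+ 2 + t^-1 * z ^+ 2 - y * z * 2 = t * (y - t^-1 * z) ^+ 2.
    by field; rewrite gt_eqF.
  by rewrite mulr_ge0 ?sqr_ge0// ltW.
Qed.

End complex_covariance.

Section decorrelation.
Context {R : realType} {d} {Omega : measurableType d} (P : probability Omega R).

Lemma char_funE (X : {RV P >-> R}) t :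
  char_fun X t = cintegral P (fun w => cis (t * X w)).
Proof. by []. Qed.

Lemma bounded_measurable_char (X : {RV P >-> R}) t :
  bounded_measurable (fun w => cis (t * X w)).
Proof. by apply: bounded_measurable_cis; exact: measurable_funM. Qed.

Lemma cmod_char_fun_le1 (X : {RV P >-> R}) t : cmod (char_fun X t) <= 1.
Proof.
apply: cmod_cintegral_bound; first exact: bounded_measurable_char.
by move=> w; rewrite cmod_cis.
Qed.

Lemma char_funD (X : {RV P >-> R}) s t : char_fun X (s + t) =
  cintegral P (fun w => cis (s * X w) * cis (t * X w)).
Proof.
by rewrite char_funE; congr cintegral; apply/funext => w; rewrite mulrDl cisD.
Qed.

Lemma char_fun0 (X : {RV P >-> R}) : char_fun X 0 = 1.
Proof.
rewrite char_funE -[RHS](cintegral_cst P); congr cintegral.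
by apply/funext => w; rewrite mul0r cis0.
Qed.

Variables (C : R) (C0 : 0 <= C).

(** The defect from multiplicativity is the covariance of two unimodular
    functions of variances at most C u^2 and C v^2; the weight t = |v| / |u|
    equalizes the two terms. *)
Lemma cmod_char_funD_le (X : {RV P >-> R}) (u v : R) :
  (forall t, 1 - cmod (char_fun X t) ^+ 2 <= C * t ^+ 2) ->
  cmod (char_fun X (u + v) - char_fun X u * char_fun X v) <= C * (`|u| * `|v|).
Proof.
move=> XC.
have [->|u0] := eqVneq u 0.
  by rewrite char_fun0 add0r mul1r subrr cmod0 normr0 mul0r mulr0.
have [->|v0] := eqVneq v 0.
  by rewrite char_fun0 addr0 mulr1 subrr cmod0 normr0 !mulr0.
have nu : 0 < `|u| by rewrite normr_gt0.
have nv : 0 < `|v| by rewrite normr_gt0.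
have t0 : 0 < `|v| / `|u| by rewrite divr_gt0.
rewrite char_funD.
apply: le_trans (@cmod_ccov_le _ _ _ P _ _ _
  (bounded_measurable_char X u) (bounded_measurable_char X v) _ _ t0) _.
- by move=> w; rewrite cmod_cis.
- by move=> w; rewrite cmod_cis.
rewrite ler_pdivrMr// -!char_funE.
apply: (@le_trans _ _ ((`|v| / `|u|) * (C * u ^+ 2) +
                       (`|v| / `|u|)^-1 * (C * v ^+ 2))).
  by apply: lerD; rewrite ler_wpM2l ?invr_ge0 ?(ltW t0).
rewrite -[u ^+ 2]real_normK ?num_real// -[v ^+ 2]real_normK ?num_real//.
rewrite le_eqVlt; apply/orP; left; apply/eqP.
by field; rewrite !gt_eqF.
Qed.

(** The quadratic bound is sharper for small frequencies and the trivial bound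
    for large ones; both lie below the power of exponent q. *)
Lemma cmod_char_funD_powR_le (X : {RV P >-> R}) (u v q : R) : 0 < q <= 1 ->
  (forall t, 1 - cmod (char_fun X t) ^+ 2 <= C * t ^+ 2) ->
  cmod (char_fun X (u + v) - char_fun X u * char_fun X v) <=
  (C + 2) * (`|u| * `|v|) `^ q.
Proof.
move=> /andP[q0 q1] XC; set y := `|u| * `|v|.
have y0 : 0 <= y by rewrite mulr_ge0.
have h := cmod_char_funD_le u v XC; rewrite -/y in h.
have h2 : cmod (char_fun X (u + v) - char_fun X u * char_fun X v) <= 2.
  apply: cmodB_le2; first exact: cmod_char_fun_le1.
  by rewrite cmodM mulr_ile1 ?cmod_ge0 ?cmod_char_fun_le1.
have C2 : 0 <= C + 2 by rewrite addr_ge0.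
have [y1|y1] := leP y 1; last first.
  apply: le_trans h2 _.
  have y1q : 1 <= y `^ q.
    by have := ler_powR (ltW y1) (ltW q0); rewrite powRr0.
  by apply: (@le_trans _ _ ((C + 2) * 1));
    [rewrite mulr1 lerDr|rewrite ler_wpM2l].
apply: le_trans h _.
have yq : y <= y `^ q.
  move: y0; rewrite le_eqVlt => /predU1P[<-|y0]; first by rewrite powR_ge0.
  by apply: ger1_powR; rewrite ?y0.
apply: (@le_trans _ _ (C * y `^ q)); first by rewrite ler_wpM2l.
by rewrite ler_wpM2r ?powR_ge0// lerDl.
Qed.

(** Characteristic functions of sums of independent variables are products, so
    the covariance is a difference of products, to be compared one factor at a
    time. *)
Lemma cmod_ccov_cis_sum_le (I : choiceType) (X : I -> {RV P >-> R})
    (u v : I -> R) (q : R) (r : seq I) :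
  mutually_independent X -> 0 < q <= 1 -> uniq r ->
  (forall i t, 1 - cmod (char_fun (X i) t) ^+ 2 <= C * t ^+ 2) ->
  cmod (ccov P (fun w => cis (\sum_(i <- r) u i * X i w))
               (fun w => cis (\sum_(i <- r) v i * X i w))) <=
  \sum_(i <- r) (C + 2) * (`|u i| * `|v i|) `^ q.
Proof.
move=> iX q01 ur XC.
have prodE (s : I -> R) :
    cintegral P (fun w => cis (\sum_(i <- r) s i * X i w)) =
    \prod_(i <- r) char_fun (X i) (s i).
  under eq_fun do rewrite cis_sum.
  apply: (cintegral_prod_independent iX (g := fun i x => cis (s i * x)))
    => // i.
  by apply: bounded_measurable_cis; exact: mulrl_measurable.
have -> : ccov P (fun w => cis (\sum_(i <- r) u i * X i w))
               (fun w => cis (\sum_(i <- r) v i * X i w)) =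
    \prod_(i <- r) char_fun (X i) (u i + v i) -
    \prod_(i <- r) (char_fun (X i) (u i) * char_fun (X i) (v i)).
  rewrite /ccov !prodE big_split /=; congr (_ - _).
  rewrite -prodE; congr cintegral; apply/funext => w; rewrite -cisD -big_split;
    congr cis.
  by apply: eq_bigr => i _; rewrite mulrDl.
apply: le_trans (cmod_prodB _ _ _) _.
- by move=> i; exact: cmod_char_fun_le1.
- by move=> i; rewrite cmodM mulr_ile1 ?cmod_ge0 ?cmod_char_fun_le1.
- by apply: ler_sum => i _; exact: cmod_char_funD_powR_le.
Qed.

End decorrelation.

(** * Normally convergent series of functions *)

Section normal_convergence.
Context {R : realType} {d} {T : measurableType d} (P : probability T R).

Lemma partial_sum_le (c : nat -> R) : (forall j, 0 <= c j) ->
  (\sum_(0 <= j <oo) (c j)%:E < +oo)%E ->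
  forall N, \sum_(0 <= j < N) c j <= fine (\sum_(0 <= j <oo) (c j)%:E)%E.
Proof.
move=> c0 coo N.
have c0' j : (0 <= (c j)%:E)%E by rewrite lee_fin.
rewrite -lee_fin -sumEFin fineK.
  by apply: (nneseries_lim_ge N) => j _ _.
by rewrite ge0_fin_numE// nneseries_ge0.
Qed.

Variables (u : nat -> T -> R[i]) (c : nat -> R).
Hypotheses (c0 : forall j, 0 <= c j)
  (coo : (\sum_(0 <= j <oo) (c j)%:E < +oo)%E)
  (bu : forall j, bounded_measurable (u j))
  (uc : forall j x, cmod (u j x) <= c j).

Let A := fine (\sum_(0 <= j <oo) (c j)%:E)%E.

(** The real and the imaginary series converge absolutely. *)
Lemma cvg_normal_series x :
  (series (fun j => u j x) : nat -> R[i]^o) @ \oo --> (sum_series u x : R[i]^o).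
Proof.
have cc : cvgn (series c).
  apply: nondecreasing_is_cvgn; first exact: nondecreasing_series.
  by exists A => _ [N _ <-]; rewrite /series /=; exact: partial_sum_le.
have rc (h : R[i] -> R) : (forall z, `|h z| <= cmod z) ->
    cvgn (series (fun j => h (u j x))).
  move=> hz; apply: normed_cvg; apply: series_le_cvg cc => // j /=;
    first exact: normr_ge0.
  exact: le_trans (hz _) (uc j x).
apply: cvgP.
apply: (@cvg_complex _ _ (limn (series (fun j => complex.Re (u j x))) +i*
                          limn (series (fun j => complex.Im (u j x))))) => /=.
- have := rc _ (@normr_Re_le R); rewrite /series /=.
  by under eq_fun do rewrite -Re_sum.
- have := rc _ (@normr_Im_le R); rewrite /series /=.
  by under eq_fun do rewrite -Im_sum.
Qed.

Lemma bounded_measurable_series N :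
  bounded_measurable (fun x => series (fun j => u j x) N).
Proof. exact: bounded_measurable_sum. Qed.

Lemma cmod_series_le N x : cmod (series (fun j => u j x) N) <= A.
Proof.
apply: le_trans (cmod_sum _ _ _) _.
apply: le_trans (partial_sum_le c0 coo N); exact: ler_sum.
Qed.

Lemma cmod_sum_series_le x : cmod (sum_series u x) <= A.
Proof.
by apply: cmod_lim_le (@cvg_normal_series x) _ => N; exact: cmod_series_le.
Qed.

Lemma bounded_measurable_sum_series : bounded_measurable (sum_series u).
Proof.
split; last by exists A; exact: cmod_sum_series_le.
- apply: (measurable_fun_cvg
    (h := fun N x => complex.Re (series (fun j => u j x) N))).
    by move=> N; have [] := bounded_measurable_series N.
  by move=> x _; exact: cvg_Re (@cvg_normal_series x).
- apply: (measurable_fun_cvg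
    (h := fun N x => complex.Im (series (fun j => u j x) N))).
    by move=> N; have [] := bounded_measurable_series N.
  by move=> x _; exact: cvg_Im (@cvg_normal_series x).
Qed.

Lemma integral_cmod_sqr (F : T -> R[i]) : bounded_measurable F ->
  (\int[P]_x (cmod (F x) ^+ 2)%:E)%E = (\int[P]_x (cmod (F x) ^+ 2))%:E.
Proof.
move=> bF; rewrite /Rintegral fineK//; apply: integrable_fin_num => //.
have := integrable_cmod P (bounded_measurableM bF bF).
by under eq_fun do rewrite cmodM -expr2.
Qed.

(** On a probability space, uniformly bounded pointwise convergence gives
    convergence in L^2. *)
Lemma normal_series_well_defined_in_L2 : well_defined_in_L2 P u.
Proof.
have bS := bounded_measurable_sum_series.
have A0 : 0 <= A.
  by rewrite fine_ge0// nneseries_ge0// => j _ _; rewrite lee_fin.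
split.
- by move=> x; exact: cvgP (@cvg_normal_series x).
- have [S1 S2 _] := bS; split => //.
  by rewrite integral_cmod_sqr// ltry.
- have bD N : bounded_measurable
      (fun x => series (fun j => u j x) N - sum_series u x).
    by apply: bounded_measurableB => //; exact: bounded_measurable_series.
  under eq_fun do rewrite integral_cmod_sqr//.
  apply: cvg_EFin; first exact: nearW.
  have -> : 0 = \int[P]_x 0 :> R by rewrite Rintegral_cst// mul0r.
  apply: (@cvg_Rintegral_bounded _ _ _ P _ _ ((A + A) ^+ 2)) => //.
  + by move=> N; apply: measurable_funX; exact: measurable_cmod.
  + move=> N x; rewrite ger0_norm ?sqr_ge0// ler_pXn2r ?nnegrE ?cmod_ge0
    ?addr_ge0//.
    apply: le_trans (cmodD _ _) _; rewrite cmodN; apply: lerD.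
      exact: cmod_series_le.
    exact: cmod_sum_series_le.
  + apply: aeW => x; have h := cvg_cmod0 (@cvg_normal_series x).
    have h2 := cvgM h h; rewrite mul0r in h2.
    by under eq_fun do rewrite expr2; exact: h2.
Qed.

End normal_convergence.

Section complex_covariance_limits.
Context {R : realType} {d} {T : measurableType d} (P : probability T R).

Lemma cvg_ccov (F G : nat -> T -> R[i]) (f g : T -> R[i]) (M N : R) :
  (forall n, bounded_measurable (F n)) ->
  (forall n, bounded_measurable (G n)) ->
  bounded_measurable f -> bounded_measurable g ->
  (forall n x, cmod (F n x) <= M) -> (forall n x, cmod (G n x) <= N) ->
  {ae P, forall x, (fun n => F n x : R[i]^o) @ \oo --> (f x : R[i]^o)} ->
  {ae P, forall x, (fun n => G n x : R[i]^o) @ \oo --> (g x : R[i]^o)} ->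
  (fun n => ccov P (F n) (G n) : R[i]^o) @ \oo --> (ccov P f g : R[i]^o).
Proof.
move=> bF bG bf bg FM GN Ff Gg; apply: cvg_complexB.
  apply: (@cvg_cintegral _ _ _ _ _ _ (M * N)).
  - by move=> n; exact: bounded_measurableM.
  - exact: bounded_measurableM.
  - by move=> n x; rewrite cmodM ler_pM ?cmod_ge0.
  - by apply: filterS2 Ff Gg => x Ff Gg; exact: cvg_complexM.
by apply: cvg_complexM; [exact: (@cvg_cintegral _ _ _ _ _ _ M)|
                         exact: (@cvg_cintegral _ _ _ _ _ _ N)].
Qed.

Lemma ccov_sum (I J : Type) (r : seq I) (s : seq J)
    (a : I -> R[i]) (b : J -> R[i])
    (F : I -> T -> R[i]) (G : J -> T -> R[i]) :
  (forall i, bounded_measurable (F i)) ->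
  (forall j, bounded_measurable (G j)) ->
  ccov P (fun x => \sum_(i <- r) a i * F i x)
         (fun x => \sum_(j <- s) b j * G j x) =
  \sum_(i <- r) \sum_(j <- s) a i * b j * ccov P (F i) (G j).
Proof.
move=> bF bG.
have bcst (c : R[i]) := bounded_measurable_cst (T := T) c.
have baF i : bounded_measurable (fun x => a i * F i x).
  exact: bounded_measurableM.
have bbG j : bounded_measurable (fun x => b j * G j x).
  exact: bounded_measurableM.
have bFG i j : bounded_measurable (fun x => F i x * G j x).
  exact: bounded_measurableM.
have babFG i j : bounded_measurable (fun x => a i * b j * (F i x * G j x)).
  exact: bounded_measurableM.
rewrite /ccov (cintegral_sum _ _ baF) (cintegral_sum _ _ bbG).
have -> : (fun x => (\sum_(i <- r) a i * F i x) * (\sum_(j <- s) b j * G j x)) =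
    (fun x => \sum_(i <- r) \sum_(j <- s) a i * b j * (F i x * G j x)).
  apply/funext => x; rewrite mulr_suml; apply: eq_bigr => i _.
  by rewrite mulr_sumr; apply: eq_bigr => j _; ring.
rewrite cintegral_sum; last by move=> i; exact: bounded_measurable_sum.
rewrite mulr_suml -sumrB; apply: eq_bigr => i _.
rewrite cintegral_sum// mulr_sumr -sumrB; apply: eq_bigr => j _.
by rewrite !cintegralZl//; ring.
Qed.

End complex_covariance_limits.

(** * Invariance of a mixing measure *)

Section mixing_invariance.
Context {R : realType} {d} {E : measurableType d} (mu : probability E R).
Variables (tau : E -> E) (mtau : measurable_fun setT tau).
Hypothesis mix : mixing mu tau.

(** With A the whole space, mixing says that mu (tau^-n B) tends to mu B; the
    same sequence, shifted by one, tends to mu (tau^-1 B). *)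
Lemma mixing_invariant (B : set E) : measurable B -> mu (tau @^-1` B) = mu B.
Proof.
move=> mB; have lim A : measurable A ->
    (fun n => mu (iter n tau @^-1` A)) @ \oo --> mu A.
  move=> mA; have := mix measurableT mA.
  by rewrite [X in (X * _)%E]probability_setT mul1e;
    under eq_fun do rewrite setTI.
have mtB : measurable (tau @^-1` B).
  by rewrite -[X in measurable X]setTI; exact: mtau.
have shifted : (fun n => mu (iter n.+1 tau @^-1` B)) @ \oo --> mu B.
  by have := lim B mB; rewrite -cvg_shiftS.
have iterated :
    (fun n => mu (iter n.+1 tau @^-1` B)) @ \oo --> mu (tau @^-1` B).
  exact: lim.
by rewrite -(cvg_lim _ iterated)// (cvg_lim _ shifted).
Qed.

Lemma cintegral_mixing_iter (g : E -> R[i]) n : bounded_measurable g ->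
  cintegral mu (fun z => g (iter n tau z)) = cintegral mu g.
Proof.
have step h : bounded_measurable h ->
    cintegral mu (fun z => h (tau z)) = cintegral mu h.
  have Rstep (r : E -> R) : measurable_fun setT r ->
      mu.-integrable setT (EFin \o (r \o tau)) ->
      \int[mu]_x r (tau x) = \int[mu]_x r x.
    move=> mr ir; congr fine.
    have mEr : measurable_fun setT (EFin \o r) by exact/measurable_EFinP.
    rewrite -[LHS](integral_pushforward mtau mEr ir measurableT).
    by apply: eq_measure_integral => A mA _; exact: mixing_invariant.
  move=> bh; have [h1 h2 _] := bh; have bht := bounded_measurable_comp mtau bh.
  apply: complex_ext.
  - exact: (Rstep _ h1 (integrable_Re mu bht)).
  - exact: (Rstep _ h2 (integrable_Im mu bht)).
elim: n g => // n IH g bg.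
rewrite -(step g bg) -(IH (fun z => g (tau z)))//.
exact: bounded_measurable_comp.
Qed.

Lemma correlation_mixing (f g : E -> R[i]) n : bounded_measurable g ->
  correlation mu tau n f g = ccov mu f (fun z => g (iter n tau z)).
Proof. by move=> bg; rewrite /ccov cintegral_mixing_iter. Qed.

End mixing_invariance.

(** * Continuous linear maps on l^p *)

Section real_norm.
Context {R : realType}.

Lemma rnormE {V : normedModType R[i]} (v : V) : (rnorm v)%:C = `|v|.
Proof. by rewrite /rnorm RRe_real// normr_real. Qed.

Lemma rnormZ {V : normedModType R[i]} (c : R[i]) (v : V) :
  rnorm (c *: v) = cmod c * rnorm v.
Proof. by apply: (@complexI R); rewrite rmorphM /= cmodE !rnormE normrZ. Qed.

(** Continuity at the origin gives a ball on which the map is bounded by one,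
    and homogeneity rescales it to the unit ball. *)
Lemma continuous_linear_bounded_on_ball {V W : normedModType R[i]}
    (f : {linear V -> W}) : continuous f ->
  exists2 M : R, 0 <= M & forall z, rnorm z <= 1 -> rnorm (f z) <= M.
Proof.
move=> cf; have /nbhs_ballP[e e0 He] : (f @ nbhs (0 : V)) (ball (f 0) 1).
  by apply: cf; exact: nbhsx_ballx.
have [r r0 er] : exists2 r : R, 0 < r & e = r%:C.
  move: e0; rewrite /= ltcE /= => /andP[/eqP ei er];
    exists (complex.Re e) => //.
  by apply: complex_ext.
exists (2 / r); first by rewrite divr_ge0// ltW.
move=> z z1; pose a : R := r / 2.
have a0 : 0 < a by rewrite divr_gt0.
have : ball (f 0) 1 (f (a%:C *: z)).
  apply: He; rewrite er -ball_normE /= sub0r normrN -rnormE ltcR rnormZ.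
  rewrite cmod_real (gtr0_norm a0); apply: le_lt_trans (_ : a < r).
    by rewrite -[leRHS]mulr1 ler_wpM2l// ltW.
  by rewrite /a; lra.
rewrite -ball_normE /= linear0 sub0r normrN linearZ -rnormE.
rewrite -[X in _ < X]/(1%:C) ltcR rnormZ cmod_real (gtr0_norm a0) => h.
rewrite -[2 / r]invrK invf_div -/a -[leRHS]mul1r ler_pdivlMr// mulrC.
exact: ltW.
Qed.

End real_norm.

Section lp_operators.
Context {R : realType} (p : R) (p1 : 1 <= p).
Local Notation E := (ellp p1).

Lemma rnorm_lp_basis n : rnorm (lp_basis p1 n) = 1.
Proof.
have p0 : 0 < p by exact: lt_le_trans p1.
rewrite rnorm_ellp /lp_norm /lp_sum.
rewrite (nneseries_split 0 n.+1); last first.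
  by move=> k _; rewrite lee_fin powR_ge0.
rewrite add0n eseries0 ?adde0; last first.
  by move=> k /= nk _; rewrite gtn_eqF// cmod0 powR0// gt_eqF.
rewrite sumEFin big_nat_recr//= eqxx cmod1 powR1 big1_seq ?add0r ?powR1// => k.
rewrite mem_index_iota => /andP[_ /andP[_ kn]].
by rewrite ltn_eqF// cmod0 powR0// gt_eqF.
Qed.

Lemma dual_basis_bounded (xs : dual E) :
  exists2 M : R, 0 < M & forall n, cmod (xs (lp_basis p1 n)) <= M.
Proof.
have [M M0 HM] := continuous_linear_bounded_on_ball (@dual_continuous _ _ xs).
exists (M + 1); first by rewrite ltr_wpDl.
move=> n; apply: le_trans (_ : M <= _); last by rewrite lerDl.
by apply: HM; rewrite rnorm_lp_basis.
Qed.

Lemma rnorm_le_opnorm (T : bounded_operator E) z : rnorm z <= 1 ->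
  rnorm (T z) <= opnorm T.
Proof.
move=> z1; apply: ub_le_sup; last by exists z.
have [M _ HM] := continuous_linear_bounded_on_ball (@bop_continuous _ _ T).
by exists M => _ [y y1 <-]; exact: HM.
Qed.

(** Turns the orbit of a functional under the adjoint into the orbit of a vector
    under T, where the action on basis vectors is explicit. *)
Lemma pairing_iter_adjoint (T : bounded_operator E) (xs : dual E) j z :
  pairing z (iter j (adjoint T) xs) = xs (iter j T z).
Proof.
elim: j z => //= j IH z.
by rewrite -[LHS]/(pairing (T z) (iter j (adjoint T) xs)) IH -iterSr.
Qed.

Lemma continuous_iter (T : bounded_operator E) j : continuous (iter j T).
Proof.
elim: j => [|j IH] z; first exact: cvg_id.
by apply: (@continuous_comp _ _ _ (iter j T) T);
  [exact: IH|exact: bop_continuous].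
Qed.

Lemma open_measurable_lp (A : set E) : open A -> measurable A.
Proof. by move=> oA; exact: sub_sigma_algebra. Qed.

Lemma continuous_measurable_real (h : E -> R) : continuous h ->
  measurable_fun setT h.
Proof.
move=> ch; apply: (measurability _ (RGenOInfty.measurableE R)) => //.
move=> /= _ [_ [a ->] <-]; rewrite setTI; apply: open_measurable_lp.
by apply: open_comp; [move=> z _; exact: ch|exact: rray_open].
Qed.

Lemma continuous_measurable_lp (h : E -> E) : continuous h ->
  measurable_fun setT h.
Proof.
move=> ch; apply: (@measurability _ _ _ _ _ _ (@open E)) => //.
move=> /= _ [A oA <-]; rewrite setTI; apply: open_measurable_lp.
by apply: open_comp => // z _; exact: ch.
Qed.

End lp_operators.

Section re_im_maps.
Context {R : realType} (phi : R[i] -> R) (hphi : re_im_maps phi).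

(** The real and imaginary parts, up to sign, enter only through being real
    linear and bounded by the modulus. *)
Lemma re_im_mapsD z w : phi (z + w) = phi z + phi w.
Proof.
move: hphi; case: z w => [? ?] [? ?].
by case=> [->|[->|[->|->]]] //=; rewrite opprD.
Qed.

Lemma re_im_mapsZ (t : R) z : phi (t%:C * z) = t * phi z.
Proof.
move: hphi; case: z => [? ?].
by case=> [->|[->|[->|->]]] /=; rewrite ?(mul0r, subr0, addr0, mulrN).
Qed.

Lemma normr_re_im_maps_le z : `|phi z| <= cmod z.
Proof.
by case: hphi => [->|[->|[->|->]]]; rewrite ?normrN ?normr_Re_le ?normr_Im_le.
Qed.

Lemma re_im_maps_sum I (r : seq I) (F : I -> R[i]) :
  phi (\sum_(i <- r) F i) = \sum_(i <- r) phi (F i).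
Proof.
elim: r => [|i r IH]; last by rewrite !big_cons re_im_mapsD IH.
by rewrite !big_nil -[0 in LHS](mul0r 0) -[0 * 0]/(0%:C * 0) re_im_mapsZ mul0r.
Qed.

Lemma continuous_re_im_maps : continuous (phi : R[i]^o -> R).
Proof.
move=> z A /nbhs_ballP[e e0 eA]; apply/nbhs_ballP.
exists e%:C; first by rewrite /= ltcR.
move=> w; rewrite /ball /= => zw; apply: eA; rewrite /ball /=.
have -> : phi z - phi w = phi (z - w).
  rewrite re_im_mapsD -[X in phi (- X)]mul1r -mulNr.
  have -> : -1 = (-1)%:C :> R[i] by rewrite rmorphN1.
  by rewrite re_im_mapsZ mulN1r.
by apply: le_lt_trans (normr_re_im_maps_le _) _; rewrite -ltcR cmodE.
Qed.

End re_im_maps.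

(** * Weighted shifts and the random series *)

Section weighted_shift.
Context {R : realType} (p : R) (p1 : 1 <= p).
Variables (omega k : nat -> R) (T : bounded_operator (ellp p1)).
Hypotheses (homega : forall n, 0 < omega n) (hk0 : 0 < k 0%N)
  (hk : forall n, (1 <= n)%N -> k n = k 0%N * \prod_(0 <= l < n) (omega l)^-1)
  (hT0 : T (lp_basis p1 0%N) = 0)
  (hTS : forall n, T (lp_basis p1 n.+1) = (omega n)%:C *: lp_basis p1 n).

Lemma shift_weight_gt0 n : 0 < k n.
Proof.
case: n => // n; rewrite hk// mulr_gt0// prodr_gt0// => i _.
by rewrite invr_gt0.
Qed.

Lemma shift_weightS n : k n = omega n * k n.+1.
Proof.
have kE m : k m = k 0%N * \prod_(0 <= l < m) (omega l)^-1.
  by case: m => [|m]; [rewrite big_geq// mulr1|exact: hk].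
rewrite [in RHS]kE big_nat_recr//= [in LHS]kE.
by field; rewrite gt_eqF.
Qed.

Lemma shift_weight_le_opnorm n : omega n <= opnorm T.
Proof.
have := @rnorm_le_opnorm _ _ _ T (lp_basis p1 n.+1).
rewrite hTS rnormZ !rnorm_lp_basis mulr1 cmod_real (gtr0_norm (homega n)).
exact.
Qed.

Lemma opnorm_gt0 : 0 < opnorm T.
Proof. exact: lt_le_trans (homega 0) (shift_weight_le_opnorm 0). Qed.

(** Iterating k_n = omega_n k_(n+1) with omega_n at most the operator norm. *)
Lemma shift_weight_le j m : k m <= opnorm T ^+ j * k (m + j)%N.
Proof.
elim: j m => [|j IH] m; first by rewrite expr0 mul1r addn0.
apply: le_trans (IH m) _;
  rewrite exprSr -mulrA ler_wpM2l ?exprn_ge0 ?(ltW opnorm_gt0)//.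
rewrite addnS shift_weightS ler_wpM2r ?shift_weight_le_opnorm//.
exact/ltW/shift_weight_gt0.
Qed.

Lemma iter_shift_basis j m :
  iter j T (lp_basis p1 (m + j)%N) = (k m / k (m + j)%N)%:C *: lp_basis p1 m.
Proof.
have k0 n : k n != 0 by rewrite gt_eqF// shift_weight_gt0.
elim: j m => [|j IH] m /=.
  by rewrite addn0 divff// scale1r.
rewrite addnS -addSn IH linearZ /= hTS scalerA -rmorphM /=.
congr (_%:C *: _); rewrite (shift_weightS m); ring.
Qed.

Lemma iter_shift_basis0 j m : (m < j)%N -> iter j T (lp_basis p1 m) = 0.
Proof.
elim: j => //= j IH; rewrite ltnS leq_eqVlt => /predU1P[->|/IH ->].
  by rewrite -[j in lp_basis _ j]add0n iter_shift_basis linearZ /= hT0 scaler0.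
by rewrite linear0.
Qed.

(** The weights are designed so that T^j moves k_m e_m to k_(m-j) e_(m-j). *)
Lemma cmod_dual_iter_shift (xs : dual (ellp p1)) j m :
  k m * cmod (xs (iter j T (lp_basis p1 m))) =
  if (j <= m)%N then k (m - j)%N * cmod (xs (lp_basis p1 (m - j)%N)) else 0.
Proof.
have [jm|mj] := leqP j m; last first.
  by rewrite iter_shift_basis0// linear0 cmod0 mulr0.
rewrite -{1 2}(subnK jm) iter_shift_basis linearZ /= cmodM cmod_real.
rewrite ger0_norm ?divr_ge0 ?ltW ?shift_weight_gt0// mulrA mulrCA divff
  ?mulr1//.
by rewrite gt_eqF// shift_weight_gt0.
Qed.

End weighted_shift.

Section random_series.
Context {R : realType} (p : R) (p1 : 1 <= p) (k : nat -> R).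
Context (d : measure_display) (Omega : measurableType d)
    (P : probability Omega R)
    (theta1 theta2 : nat -> {RV P >-> R})
    (hindep : mutually_independent
       (fun i : nat + nat =>
          match i with inl n => theta1 n | inr n => theta2 n end))
    (Z : {RV P >-> ellp p1})
    (hZ : {ae P, forall w,
       series (fun n => ((k n)%:C * (theta1 n w +i* theta2 n w)) *:
                        lp_basis p1 n) @ \oo --> Z w}).
Hypothesis k0 : forall n, 0 < k n.

Let X (i : nat + nat) : {RV P >-> R} :=
  match i with inl n => theta1 n | inr n => theta2 n end.

Let idx N : seq (nat + nat) := map inl (iota 0 N) ++ map inr (iota 0 N).

Let uniq_idx N : uniq (idx N).
Proof.
rewrite cat_uniq !map_inj_uniq ?iota_uniq; try by move=> ? ? [].
rewrite andbT /=; apply/hasPn => _ /mapP[n _ ->].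
by apply/mapP => -[].
Qed.

Let sum_idx N (F : nat + nat -> R) :
  \sum_(i <- idx N) F i = \sum_(0 <= m < N) (F (inl m) + F (inr m)).
Proof. by rewrite big_cat !big_map /= big_split /index_iota subn0. Qed.

(** The coefficients of theta1 and theta2 in phi (<Z, y>): the second family is
    multiplied by i in the random series. *)
Definition dual_coef (phi : R[i] -> R) (y : dual (ellp p1))
    (i : nat + nat) : R :=
  match i with
  | inl m => phi ((k m)%:C * y (lp_basis p1 m))
  | inr m => phi ((0 +i* 1) * ((k m)%:C * y (lp_basis p1 m)))
  end.

Lemma normr_dual_coef_le phi y m : re_im_maps phi ->
  `|dual_coef phi y (inl m)| <= k m * cmod (y (lp_basis p1 m)) /\
  `|dual_coef phi y (inr m)| <= k m * cmod (y (lp_basis p1 m)).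
Proof.
move=> hphi; have nk : cmod (k m)%:C = k m by rewrite cmod_real gtr0_norm.
split; apply: le_trans (normr_re_im_maps_le hphi _) _; rewrite !cmodM nk//.
have -> : cmod (0 +i* 1 : R[i]) = 1.
  by apply/eqP; rewrite -(@pexpr_eq1 _ _ 2)// ?cmod_ge0// cmod_sqr /= expr0n
    add0r expr1n.
by rewrite mul1r.
Qed.

(** A continuous functional of the random vector is the almost sure limit of
    finite sums of independent variables, to which independence applies. *)
Lemma ae_cvg_dual phi y : re_im_maps phi -> {ae P, forall w,
  (fun N => \sum_(i <- idx N) dual_coef phi y i * X i w) @ \oo -->
  phi (pairing (Z w) y)}.
Proof.
move=> hphi; apply: filterS hZ => w Zw.
have cy : continuous (phi \o y : ellp p1 -> R).
  move=> z; apply: (@continuous_comp _ _ _ y (phi : R[i]^o -> R)).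
    exact: dual_continuous.
  exact: continuous_re_im_maps.
have -> : (fun N => \sum_(i <- idx N) dual_coef phi y i * X i w) =
    (phi \o y) \o series (fun n =>
      ((k n)%:C * (theta1 n w +i* theta2 n w)) *: lp_basis p1 n); last first.
  exact: cvg_comp _ _ Zw (cy (Z w)).
apply/funext => N; rewrite sum_idx /series /= linear_sum re_im_maps_sum//.
apply: eq_bigr => m _ /=.
rewrite linearZ /=.
rewrite -[X in _ = phi X]/((k m)%:C * (theta1 m w +i* theta2 m w) *
                           y (lp_basis p1 m)).
have -> : (k m)%:C * (theta1 m w +i* theta2 m w) * y (lp_basis p1 m) =
    (theta1 m w)%:C * ((k m)%:C * y (lp_basis p1 m)) +
    (theta2 m w)%:C * ((0 +i* 1) * ((k m)%:C * y (lp_basis p1 m))).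
  by apply: complex_ext;
    rewrite ?Re_add ?Im_add ?Re_mul ?Im_mul /= ?Re_mul ?Im_mul /=; ring.
by rewrite re_im_mapsD// !re_im_mapsZ// mulrC [X in _ + X = _]mulrC.
Qed.

Lemma bounded_measurable_cis_dual phi y : re_im_maps phi ->
  bounded_measurable (fun z : ellp p1 => cis (phi (pairing z y))).
Proof.
move=> hphi; apply: bounded_measurable_cis;
  apply: continuous_measurable_real => z.
apply: (@continuous_comp _ _ _ y (phi : R[i]^o -> R)).
  exact: dual_continuous.
exact: continuous_re_im_maps.
Qed.

Variables (C q : R) (C0 : 0 <= C) (q01 : 0 < q <= 1).
Hypothesis XC : forall i t, 1 - cmod (char_fun (X i) t) ^+ 2 <= C * t ^+ 2.

(** The estimate for finite sums is uniform in the number of terms and passes to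
    the limit; the factor 2 counts the two families theta1 and theta2. *)
Lemma cmod_ccov_dual_le phi psi (y1 y2 : dual (ellp p1)) (B : R) :
  re_im_maps phi -> re_im_maps psi ->
  (forall N, \sum_(0 <= m < N) ((k m * cmod (y1 (lp_basis p1 m))) *
    (k m * cmod (y2 (lp_basis p1 m)))) `^ q <= B) ->
  cmod (ccov (distribution P Z) (fun z => cis (phi (pairing z y1)))
                                (fun z => cis (psi (pairing z y2)))) <=
  2 * (C + 2) * B.
Proof.
move=> hphi hpsi HB.
have b1 := bounded_measurable_cis_dual y1 hphi.
have b2 := bounded_measurable_cis_dual y2 hpsi.
have -> : ccov (distribution P Z) (fun z => cis (phi (pairing z y1)))
                                (fun z => cis (psi (pairing z y2))) =
    ccov P (fun w => cis (phi (pairing (Z w) y1)))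
           (fun w => cis (psi (pairing (Z w) y2))).
  rewrite /ccov !cintegral_distribution//; exact: bounded_measurableM.
have mS (u : nat + nat -> R) N :
    measurable_fun setT (fun w => \sum_(i <- idx N) u i * X i w).
  by apply: measurable_sum => i; exact: measurable_funM.
pose S phi y N w := \sum_(i <- idx N) dual_coef phi y i * X i w.
apply: (@cmod_lim_le _ (fun N => ccov P (fun w => cis (S phi y1 N w))
                                       (fun w => cis (S psi y2 N w)))).
  apply: (@cvg_ccov _ _ _ _ _ _ _ _ 1 1).
  - by move=> N; apply: bounded_measurable_cis; exact: mS.
  - by move=> N; apply: bounded_measurable_cis; exact: mS.
  - by apply: (bounded_measurable_comp _ b1).
  - by apply: (bounded_measurable_comp _ b2).
  - by move=> N w; rewrite cmod_cis.
  - by move=> N w; rewrite cmod_cis.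
  - by apply: filterS (ae_cvg_dual y1 hphi) => w; exact: cvg_cis.
  - by apply: filterS (ae_cvg_dual y2 hpsi) => w; exact: cvg_cis.
move=> N.
apply: le_trans (cmod_ccov_cis_sum_le C0 _ _ hindep q01 (uniq_idx N) XC) _.
rewrite -mulr_sumr sum_idx -mulrA mulrCA ler_wpM2l ?addr_ge0//.
apply: le_trans (_ : 2 * \sum_(0 <= m < N) ((k m * cmod (y1 (lp_basis p1 m))) *
    (k m * cmod (y2 (lp_basis p1 m)))) `^ q <= _); last by rewrite ler_wpM2l.
rewrite mulr_sumr; apply: ler_sum => m _; rewrite mulrDl !mul1r.
have [u1 u2] := normr_dual_coef_le y1 m hphi.
have [v1 v2] := normr_dual_coef_le y2 m hpsi.
have km : 0 <= k m by exact: ltW.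
have [q0 _] := andP q01.
by apply: lerD; rewrite ge0_ler_powR ?nnegrE ?mulr_ge0 ?cmod_ge0 ?(ltW q0)//
  ler_pM.
Qed.

End random_series.

(** * Covariance along the orbit of the shift *)

Lemma sum_shifted_le {R : realType} (F : nat -> R) (e N : nat) :
  (forall i, 0 <= F i) ->
  \sum_(0 <= m < N) (if (e <= m)%N then F (m - e)%N else 0) <=
  \sum_(0 <= i < N) F i.
Proof.
move=> F0; have [eN|Ne] := leqP e N; last first.
  rewrite big1_seq ?sumr_ge0// => m;
    rewrite mem_index_iota => /andP[_ /andP[_ mN]].
  by rewrite leqNgt (ltn_trans mN Ne).
rewrite (big_cat_nat _ eN)//= [X in X + _]big1_seq ?add0r; last first.
  move=> m; rewrite mem_index_iota => /andP[_ /andP[_ me]].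
  by rewrite leqNgt me.
rewrite -{1}[e]add0n big_addn.
under eq_bigr do rewrite leq_addl addnK.
rewrite [leRHS](big_cat_nat _ (leq_subr e N))//= lerDl.
exact: sumr_ge0.
Qed.

Section shift_covariance.
Context {R : realType} (p : R) (p1 : 1 <= p).
Variables (omega k : nat -> R) (T : bounded_operator (ellp p1)).
Hypotheses (homega : forall n, 0 < omega n) (hk0 : 0 < k 0%N)
  (hk : forall n, (1 <= n)%N -> k n = k 0%N * \prod_(0 <= l < n) (omega l)^-1)
  (hT0 : T (lp_basis p1 0%N) = 0)
  (hTS : forall n, T (lp_basis p1 n.+1) = (omega n)%:C *: lp_basis p1 n).
Context (d : measure_display) (Omega : measurableType d)
    (P : probability Omega R)
    (theta1 theta2 : nat -> {RV P >-> R})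
    (hindep : mutually_independent
       (fun i : nat + nat =>
          match i with inl n => theta1 n | inr n => theta2 n end))
    (Z : {RV P >-> ellp p1})
    (hZ : {ae P, forall w,
       series (fun n => ((k n)%:C * (theta1 n w +i* theta2 n w)) *:
                        lp_basis p1 n) @ \oo --> Z w}).
Variables (C q : R) (C0 : 0 <= C) (q01 : 0 < q <= 1).
Hypothesis XC : forall (i : nat + nat) t,
  1 - cmod (char_fun
      (match i with inl n => theta1 n | inr n => theta2 n end) t) ^+ 2
  <= C * t ^+ 2.

(** At coordinate m the two coefficients carry the weights k_(m-j) and k_(m-e).
    Replacing k_(m-j) by ||T||^j k_m and setting i = m - e gives the sum on the
    right; this works whether j is below or above e. *)
Lemma cmod_ccov_shift_le phi psi (xs ys : dual (ellp p1)) :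
  re_im_maps phi -> re_im_maps psi ->
  exists2 K : R, 0 < K & forall j e,
  ((cmod (ccov (distribution P Z)
     (fun z => cis (phi (pairing z (iter j (adjoint T) xs))))
     (fun z => cis (psi (pairing z (iter e (adjoint T) ys))))))%:E <=
  (K * opnorm T `^ (j%:R * q))%:E *
  \sum_(0 <= i <oo) (k i `^ q * k (i + e)%N `^ q)%:E)%E.
Proof.
move=> hphi hpsi.
have [M1 M1_gt0 xsM] := dual_basis_bounded xs.
have [M2 M2_gt0 ysM] := dual_basis_bounded ys.
have kpos n : 0 < k n by exact: shift_weight_gt0 homega hk0 hk n.
have kge n : 0 <= k n by exact: ltW.
have L0 : 0 < opnorm T by exact: opnorm_gt0 homega hTS.
have [q0 _] := andP q01.
exists (2 * (C + 2) * (M1 * M2) `^ q).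
  by rewrite !mulr_gt0 ?powR_gt0 ?mulr_gt0// ltr_wpDl.
move=> j e; set S := (\sum_(0 <= i <oo) _)%E.
have kk0 i : 0 <= k i `^ q * k (i + e)%N `^ q by rewrite mulr_ge0 ?powR_ge0.
have S0 : (0 <= S)%E by apply: nneseries_ge0 => i _ _; rewrite lee_fin.
have Kpos : 0 < 2 * (C + 2) * (M1 * M2) `^ q * opnorm T `^ (j%:R * q).
  by rewrite !mulr_gt0 ?powR_gt0 ?mulr_gt0// ltr_wpDl.
(* Only a finite right-hand side leaves something to prove. *)
have [->|Soo] := eqVneq S +oo%E; first by rewrite gt0_muley ?lte_fin// leey.
have Sfin : S \is a fin_num by rewrite ge0_fin_numE// lt_neqAle Soo leey.
rewrite -(fineK Sfin) -EFinM lee_fin.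
rewrite -(mulrA (2 * (C + 2))) -(mulrA (2 * (C + 2))).
apply: (cmod_ccov_dual_le hindep hZ kpos C0 q01 XC) => // N.
have step m : ((k m * cmod (iter j (adjoint T) xs (lp_basis p1 m))) *
    (k m * cmod (iter e (adjoint T) ys (lp_basis p1 m)))) `^ q <=
    (M1 * M2) `^ q * opnorm T `^ (j%:R * q) *
    (if (e <= m)%N then k (m - e)%N `^ q * k (m - e + e)%N `^ q else 0).
  rewrite -![iter _ (adjoint T) _ _]/(pairing _ _) !pairing_iter_adjoint.
  rewrite !(cmod_dual_iter_shift homega hk0 hk hT0 hTS).
  have [em|_] := leqP e m; last by rewrite !mulr0 powR0// gt_eqF.
  rewrite (subnK em) (powRrM _ j%:R) powR_mulrn ?(ltW L0)//.
  rewrite -!powRM ?mulr_ge0 ?exprn_ge0 ?(ltW L0) ?(ltW M1_gt0) ?(ltW M2_gt0)//.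
  have u1 : (if (j <= m)%N
      then k (m - j)%N * cmod (xs (lp_basis p1 (m - j)%N)) else 0)
      <= M1 * (opnorm T ^+ j * k m).
    case: ifPn => [jm|_]; last first.
      by rewrite !mulr_ge0 ?exprn_ge0 ?(ltW L0) ?(ltW M1_gt0).
    rewrite mulrC ler_pM ?cmod_ge0//.
    have := shift_weight_le homega hk0 hk hTS j (m - j)%N.
    by rewrite subnK.
  have u0 : 0 <= (if (j <= m)%N
      then k (m - j)%N * cmod (xs (lp_basis p1 (m - j)%N)) else 0).
    by case: ifP => _ //; rewrite mulr_ge0 ?cmod_ge0.
  have v0 : 0 <= k (m - e)%N * cmod (ys (lp_basis p1 (m - e)%N)).
    by rewrite mulr_ge0 ?cmod_ge0.
  rewrite ge0_ler_powR ?(ltW q0) ?nnegrE ?mulr_ge0 ?exprn_ge0 ?(ltW L0)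
    ?(ltW M1_gt0) ?(ltW M2_gt0) ?cmod_ge0//.
  have -> : M1 * M2 * opnorm T ^+ j * (k (m - e)%N * k m) =
      (M1 * (opnorm T ^+ j * k m)) * (k (m - e)%N * M2) by ring.
  by apply: ler_pM => //; rewrite ler_wpM2l.
apply: (le_trans (ler_sum _ (fun m _ => step m))).
rewrite -mulr_sumr ler_wpM2l ?mulr_ge0 ?powR_ge0//.
apply: le_trans (sum_shifted_le e N kk0) _.
rewrite -lee_fin (fineK Sfin) -sumEFin.
by apply: (nneseries_lim_ge N) => i _ _; rewrite lee_fin.
Qed.

End shift_covariance.

(** * The decay of correlations *)

Theorem corollary6p6 (R : realType) (alpha p : R)
    (halpha : 0 < alpha < 1) (p1 : 1 <= p) (p2 : p <= 2)
    (a_m a_p l_m l_p : R)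
    (ham : 0 < a_m) (hap : 0 < a_p) (hlm : 0 < l_m) (hlp : 0 < l_p)
    (omega : nat -> R) (homega : forall n, 0 < omega n)
    (homega_bdd : exists M : R, forall n, omega n <= M)
    (k : nat -> R) (hk0 : 0 < k 0%N)
    (hk : forall n, (1 <= n)%N -> k n = k 0%N * \prod_(0 <= l < n) (omega l)^-1)
    (hk_sum : (\sum_(0 <= n <oo) (`|k n| `^ alpha)%:E < +oo)%E)
    (d : measure_display) (Omega : measurableType d) (P : probability Omega R)
    (theta1 theta2 : nat -> {RV P >-> R})
    (htheta1 : forall n, tempered_stable alpha a_m a_p l_m l_p (theta1 n))
    (htheta2 : forall n, tempered_stable alpha a_m a_p l_m l_p (theta2 n))
    (hindep : mutually_independent
       (fun i : nat + nat =>
          match i with inl n => theta1 n | inr n => theta2 n end))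
    (Z : {RV P >-> ellp p1})
    (hZ : {ae P, forall w,
       series (fun n => ((k n)%:C * (theta1 n w +i* theta2 n w)) *:
                        lp_basis p1 n) @ \oo --> Z w})
    (mu : probability (ellp p1) R) (hmu : mu = distribution P Z)
    (T : bounded_operator (ellp p1))
    (hT0 : T (lp_basis p1 0%N) = 0)
    (hTS : forall n, T (lp_basis p1 n.+1) = (omega n)%:C *: lp_basis p1 n)
    (a b : nat -> R[i])
    (ha : (\sum_(0 <= j <oo) (cmod (a j))%:E < +oo)%E)
    (hb : (\sum_(0 <= l <oo) (cmod (b l))%:E < +oo)%E)
    (haT : (\sum_(0 <= j <oo)
       (cmod (a j) * opnorm T `^ (j%:R * p / 2))%:E < +oo)%E)
    (phi psi : R[i] -> R) (hphi : re_im_maps phi) (hpsi : re_im_maps psi)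
    (hphipsi : phi <> psi)
    (xs ys : dual (ellp p1)) :
  let f_term := fun (j : nat) (z : ellp p1) =>
    a j * cexp (0 +i* phi (pairing z (iter j (adjoint T) xs))) in
  let g_term := fun (l : nat) (z : ellp p1) =>
    b l * cexp (0 +i* psi (pairing z (iter l (adjoint T) ys))) in
  let f := sum_series f_term in
  let g := sum_series g_term in
  [/\ well_defined_in_L2 mu f_term,
      well_defined_in_L2 mu g_term &
      mixing mu T ->
      exists2 C : R, 0 < C & forall n : nat,
        ((cmod (correlation mu T n f g))%:E <=
         C%:E * \sum_(0 <= l <oo) ((cmod (b l))%:E *
           \sum_(0 <= j <oo) (k j `^ (p / 2) * k (j + l + n)%N `^ (p / 2))%:E))%E].
Proof.
move=> f_term g_term f g.
have [q0 q1] : 0 < p / 2 /\ p / 2 <= 1 by split; lra.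
have q01 : 0 < p / 2 <= 1 by rewrite q0 q1.
have bterm (c : nat -> R[i]) chi (y : nat -> dual (ellp p1)) j :
    re_im_maps chi -> @bounded_measurable R _ (ellp p1)
      (fun z => c j * cis (chi (pairing z (y j)))).
  move=> hchi; apply: bounded_measurableM; first exact: bounded_measurable_cst.
  exact: bounded_measurable_cis_dual.
have bf j : bounded_measurable (f_term j)
  by exact: (bterm a phi (fun j => iter j (adjoint T) xs)).
have bg l : bounded_measurable (g_term l)
  by exact: (bterm b psi (fun j => iter j (adjoint T) ys)).
have fa j z : cmod (f_term j z) <= cmod (a j).
  by rewrite /f_term cmodM -[cexp _]/(cis _) cmod_cis mulr1.
have gb l z : cmod (g_term l z) <= cmod (b l).
  by rewrite /g_term cmodM -[cexp _]/(cis _) cmod_cis mulr1.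
have a0 j : 0 <= cmod (a j) by exact: cmod_ge0.
have b0 l : 0 <= cmod (b l) by exact: cmod_ge0.
split.
- exact: (normal_series_well_defined_in_L2 mu a0 ha bf fa).
- exact: (normal_series_well_defined_in_L2 mu b0 hb bg gb).
move=> mixT.
have [C C0 XC] := tempered_stable_char_fun_defect halpha ham hap hlm hlp P.
have XC' (i : nat + nat) t : 1 - cmod (char_fun
    (match i with inl n => theta1 n | inr n => theta2 n end) t) ^+ 2
    <= C * t ^+ 2.
  by case: i => n; exact: XC.
have [K K0 HK] := cmod_ccov_shift_le homega hk0 hk hT0 hTS hindep hZ C0 q01 XC'
  xs ys hphi hpsi.
pose al j := cmod (a j) * opnorm T `^ (j%:R * p / 2).
have al0 j : 0 <= al j by rewrite mulr_ge0 ?powR_ge0.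
have [A A0 HA] : exists2 A : R, 0 <= A & forall N, \sum_(0 <= j < N) al j <= A.
  exists (fine (\sum_(0 <= j <oo) (al j)%:E)%E); last exact: partial_sum_le.
  by rewrite fine_ge0// nneseries_ge0// => j _ _; rewrite lee_fin.
have KA0 : 0 < K * A + K by rewrite ltr_wpDl// mulr_ge0// ltW.
(* K is added because A may vanish, and the constant must be positive. *)
exists (K * A + K) => // n; set W := (\sum_(0 <= l <oo) _)%E.
pose S e := (\sum_(0 <= i <oo) (k i `^ (p / 2) * k (i + e)%N `^ (p / 2))%:E)%E.
have S0 e : (0 <= S e)%E.
  by apply: nneseries_ge0 => i _ _; rewrite lee_fin mulr_ge0 ?powR_ge0.
have bS0 l : (0 <= (cmod (b l))%:E * S (l + n)%N)%E
  by rewrite mule_ge0 ?lee_fin.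
have WE : W = (\sum_(0 <= l <oo) ((cmod (b l))%:E * S (l + n)%N))%E.
  apply: eq_eseriesr => l _; congr (_ * _)%E.
  by apply: eq_eseriesr => i _; rewrite addnA.
have W0 : (0 <= W)%E by rewrite WE nneseries_ge0.
have WN N : (\sum_(0 <= l < N) (cmod (b l))%:E * S (l + n)%N <= W)%E.
  by rewrite WE; apply: (nneseries_lim_ge N) => l _ _.
pose u j z := cis (phi (pairing z (iter j (adjoint T) xs))).
pose v e z := cis (psi (pairing z (iter e (adjoint T) ys))).
have HKS j e : ((cmod (ccov mu (u j) (v e)))%:E <=
    (K * opnorm T `^ (j%:R * p / 2))%:E * S e)%E.
  by rewrite hmu -mulrA; exact: HK.
clearbody S; clear WE HK; clearbody W.
(* Only a finite right-hand side leaves something to prove. *)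
have [->|Woo] := eqVneq W +oo%E; first by rewrite gt0_muley ?lte_fin// leey.
have Wfin : W \is a fin_num by rewrite ge0_fin_numE// lt_neqAle Woo leey.
rewrite -(fineK Wfin) -EFinM lee_fin.
have mT : measurable_fun setT (T : ellp p1 -> ellp p1).
  by apply: continuous_measurable_lp; exact: bop_continuous.
have mTn : measurable_fun setT (iter n T : ellp p1 -> ellp p1).
  by apply: continuous_measurable_lp; exact: continuous_iter.
pose F N z := series (fun j => f_term j z) N.
pose G N z := series (fun l => g_term l z) N.
have bF N : bounded_measurable (F N) by exact: bounded_measurable_series.
have bG N : bounded_measurable (fun z => G N (iter n T z)).
  by apply: (bounded_measurable_comp mTn); exact: bounded_measurable_series.
have bsf : bounded_measurable f
  by exact: (bounded_measurable_sum_series a0 ha bf fa).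
have bg_sum : bounded_measurable g
  by exact: (bounded_measurable_sum_series b0 hb bg gb).
have bsg : bounded_measurable (fun z => g (iter n T z)).
  exact: (bounded_measurable_comp mTn).
have cF z : (fun N => F N z : R[i]^o) @ \oo --> (f z : R[i]^o).
  exact: (@cvg_normal_series _ _ _ _ _ a0 ha fa z).
have cG z : (fun N => G N z : R[i]^o) @ \oo --> (g z : R[i]^o).
  exact: (@cvg_normal_series _ _ _ _ _ b0 hb gb z).
have leF N z : cmod (F N z) <= fine (\sum_(0 <= j <oo) (cmod (a j))%:E)%E.
  exact: (cmod_series_le a0 ha fa).
have leG N z : cmod (G N z) <= fine (\sum_(0 <= l <oo) (cmod (b l))%:E)%E.
  exact: (cmod_series_le b0 hb gb).
have cvgI :
    (fun N => ccov mu (F N) (fun z => G N (iter n T z)) : R[i]^o) @ \oo -->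
    (ccov mu f (fun z => g (iter n T z)) : R[i]^o).
  apply: (@cvg_ccov _ _ _ mu F (fun N z => G N (iter n T z)) f
    (fun z => g (iter n T z)) _ _ bF bG bsf bsg leF
    (fun N z => leG N (iter n T z))).
  - by apply: aeW => z; exact: cF.
  - by apply: aeW => z; exact: cG.
rewrite (correlation_mixing mT mixT f n bg_sum).
apply: (cmod_lim_le cvgI) => N.
(* <T^n z, T*^l y> = <z, T*^(l+n) y>: the time n is absorbed in the index. *)
have Gv : (fun z => G N (iter n T z)) =
    (fun z => \sum_(0 <= l < N) b l * v (l + n)%N z).
  apply/funext => z; apply: eq_bigr => l _; congr (_ * cis (psi _)).
  by rewrite !pairing_iter_adjoint iterD.
rewrite Gv /F /series /=.
rewrite (ccov_sum mu _ _ a b (F := u) (G := fun l => v (l + n)%N));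
  last 2 first.
- by move=> j; exact: bounded_measurable_cis_dual.
- by move=> l; exact: bounded_measurable_cis_dual.
apply: le_trans (cmod_sum _ _ _) _.
rewrite -lee_fin -sumEFin EFinM (fineK Wfin).
apply: (@le_trans _ _ (\sum_(0 <= j < N) (K * al j)%:E * W)%E).
  apply: lee_sum => j _.
  apply: (@le_trans _ _ (\sum_(0 <= l < N) (K * al j)%:E *
      ((cmod (b l))%:E * S (l + n)%N))%E); last first.
    rewrite -ge0_sume_distrr//; apply: lee_wpmul2l.
      by rewrite lee_fin mulr_ge0// ltW.
    exact: WN.
  apply: le_trans (_ : (\sum_(0 <= l < N) (cmod (a j * b l *
    ccov mu (u j) (v (l + n)%N)))%:E <= _)%E).
    by rewrite sumEFin lee_fin cmod_sum.
  apply: lee_sum => l _.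
  have -> : cmod (a j * b l * ccov mu (u j) (v (l + n)%N)) =
      (cmod (a j) * cmod (b l)) * cmod (ccov mu (u j) (v (l + n)%N)).
    by rewrite !cmodM.
  rewrite EFinM; have := HKS j (l + n)%N.
  move=> /(lee_wpmul2l (_ : 0%E <= (cmod (a j) * cmod (b l))%:E)%E) h.
  apply: le_trans (h _) _; first by rewrite lee_fin mulr_ge0.
  rewrite !muleA -!EFinM.
  have -> : cmod (a j) * cmod (b l) * (K * opnorm T `^ (j%:R * p / 2)) =
      K * al j * cmod (b l) by rewrite /al; ring.
  exact: lexx.
rewrite -ge0_sume_distrl; last by move=> j _; rewrite lee_fin mulr_ge0// ltW.
apply: lee_wpmul2r => //.
rewrite sumEFin lee_fin -mulr_sumr; apply: (@le_trans _ _ (K * A)).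
  by rewrite ler_wpM2l// ltW.
by rewrite lerDl ltW.
Qed.
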